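(* Let $\mathbb{X}$ be a right Markov process on $E$ and let $m$ be an excessive ($\sigma$-finite) measure for $\mathbb{X}$. Let $\mathcal{B}_1=\{u\in\mathcal{B}^+(E): u(x)\le1,\ x\in E\}$. Then $(\mathbb{X},\mathcal{B}_1,m)$ has the compactness property if and only if $R_\alpha:L^1(E;m)\to L^1(E;m)$ is order compact for some (and hence for every) $\alpha>0$.
   Context: $E$ is a Radon metrizable topological space; $\mathcal{B}^+(E)$ denotes the nonnegative Borel functions on $E$. $\mathbb{X}=(\{X_t\},\{P_x\})$ is a right Markov process with cemetery $\Delta$, functions being extended by $f(\Delta)=0$, and $R_\alpha f(x)=E_x\int_0^\infty e^{-\alpha t}f(X_t)\,dt$. A $\sigma$-finite Borel measure $m$ on $E$ is excessive if $\int\alpha R_\alpha f\,dm\le\int f\,dm$ for all $\alpha>0$ and $f\in\mathcal{B}^+(E)$; in particular $R_\alpha$ acts as a bounded operator on $L^1(E;m)$. $R_\alpha$ is order compact on $L^1(E;m)$ if for every nonnegative $v\in L^1(E;m)$ it maps the order interval $[0,v]=\{u\in L^1(E;m):0\le u\le v\}$ onto a relatively compact subset of $L^1(E;m)$. $(\mathbb{X},\mathcal{P},m)$ has the compactness property if for every sequence $\{u_n\}\subset\mathcal{P}$ there exist a set $\Lambda\subset(0,\infty)$ with $\sup\Lambda=+\infty$ and a subsequence $(n')\subset(n)$ such that for every $\alpha\in\Lambda$ the sequence $\{R_\alpha u_{n'}\}$ converges $m$-a.e. and its limit is $m$-a.e. finite. *)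

(* Defs.v *)
From HB Require Import structures.
From mathcomp Require Import all_boot all_order all_algebra.
From mathcomp Require Import all_classical all_reals all_analysis.
From mathcomp Require Import measurable_realfun.

Set Implicit Arguments.
Unset Strict Implicit.
Unset Printing Implicit Defensive.

Import Order.TTheory GRing.Theory Num.Theory.
Import numFieldNormedType.Exports.

Local Open Scope classical_set_scope.
Local Open Scope ring_scope.
Local Open Scope ereal_scope.

Notation Borel E := (g_sigma_algebraType (@open E)).

(** ** Universal measurability and Radon spaces *)

Definition univ_measurable (R : realType) d (T : measurableType d)
    (A : set T) : Prop :=
  forall mu : {finite_measure set T -> \bar R},
    exists B C : set T, [/\ measurable B, measurable C,
      B `<=` A, A `<=` C & mu (C `\` B) = 0].

Definition univ_measurable_fun (R : realType) d (T : measurableType d)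
    (f : T -> \bar R) : Prop :=
  forall B : set (\bar R), measurable B -> univ_measurable R (f @^-1` B).

(** A metrizable space is Radon if it is homeomorphic to a universally
    measurable subset of a compact metric space.  A Hausdorff pseudometric
    space is a metric space. *)
Definition radon_metrizable (R : realType) (E : ptopologicalType) : Prop :=
  exists (K : pseudoPMetricType R) (j : E -> K),
    [/\ hausdorff_space K, compact [set: K], injective j,
        forall U : set E,
          open U <-> exists2 V : set K, open V & U = j @^-1` V
      & univ_measurable R (range j : set (Borel K))].

(** ** Right processes

    The state space with cemetery is [option E], the cemetery being [None];
    [oapp f 0] is the extension of [f] by [0] at the cemetery.  Times are
    elements of [R] and only the values of [X t] for [0 <= t] matter. *)

Section RightProcess.
Context (R : realType) (E : ptopologicalType).
Context (dO : measure_display) (Omega : measurableType dO).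
Variables (X : R -> Omega -> option E) (P : E -> probability Omega R).

Definition Bplus : set (E -> \bar R) :=
  [set f | measurable_fun [set: Borel E] (f : Borel E -> \bar R) /\
           forall x, 0 <= f x].

Definition semigroup (t : R) (f : E -> \bar R) (x : E) : \bar R :=
  \int[P x]_w oapp f 0 (X t w).

Definition resolvent (a : R) (f : E -> \bar R) (x : E) : \bar R :=
  \int[P x]_w \int[lebesgue_measure]_(t in `[0%R, +oo[)
    ((expR (- (a * t)))%:E * oapp f 0 (X t w)).

Definition natural_filtration (t : R) : set (set Omega) :=
  <<s [set A | exists (r : R) (B : set (Borel E)),
         [/\ (0 <= r <= t)%R, measurable B & A = X r @^-1` (Some @` B)]] >>.

Definition alpha_excessive (a : R) (f : E -> \bar R) : Prop :=
  [/\ univ_measurable_fun (f : Borel E -> \bar R),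
      forall x, 0 <= f x,
      forall (t : R) x, (0 <= t)%R ->
        (expR (- (a * t)))%:E * semigroup t f x <= f x
    & forall x, (expR (- (a * t)))%:E * semigroup t f x @[t --> 0^'+] --> f x].

(** The two "hypotheses droites" of Meyer, in the form used by Sharpe, for the
    process killed at its lifetime.  The clause on [Some x] is right continuity
    on [[0, lifetime[]; after the lifetime the path is constant.  In
    [rp_excessive], the integral of [fun x => P x N] is the probability of [N]
    under the initial law [mu].  Functions of the form [semigroup t f] are only
    universally measurable; for a nonnegative function [g] the library integral
    is the supremum of the integrals of the measurable simple functions below
    [g], which for such [g] is the integral against the completed measure. *)
Record right_process : Prop := RightProcess {
  rp_measurable : forall (t : R) (B : set (Borel E)),
    (0 <= t)%R -> measurable B -> measurable (X t @^-1` (Some @` B));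
  rp_kernel : forall A : set Omega, measurable A ->
    univ_measurable_fun ((fun x => P x A) : Borel E -> \bar R);
  rp_normal : forall x, P x (X 0%R @^-1` [set Some x]) = 1;
  rp_cemetery : forall (s t : R) w,
    (0 <= s <= t)%R -> X s w = None -> X t w = None;
  rp_right_continuous : forall (t : R) w x, (0 <= t)%R -> X t w = Some x ->
    forall U : set E, nbhs x U ->
      \forall s \near t^'+, (Some @` U) (X s w);
  rp_markov : forall (x : E) (s t : R) (f : E -> \bar R) (A : set Omega),
    (0 <= s)%R -> (0 <= t)%R -> Bplus f -> natural_filtration t A ->
    \int[P x]_(w in A) oapp f 0 (X (t + s)%R w) =
    \int[P x]_(w in A) oapp (semigroup s f) 0 (X t w);
  rp_excessive : forall (a : R) (f : E -> \bar R),
    (0 < a)%R -> alpha_excessive a f ->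
    forall mu : probability (Borel E) R,
      exists N : set Omega, [/\ measurable N, \int[mu]_x P x N = 0
        & forall w, ~ N w -> forall t : R, (0 <= t)%R ->
            oapp f 0 (X s w) @[s --> t^'+] --> oapp f 0 (X t w)]
}.

Definition excessive_measure (m : {measure set (Borel E) -> \bar R}) : Prop :=
  forall (a : R) (f : E -> \bar R), (0 < a)%R -> Bplus f ->
    \int[m]_x (a%:E * resolvent a f x) <= \int[m]_x f x.

Definition B1 : set (E -> \bar R) :=
  [set u | Bplus u /\ forall x, u x <= 1].

(** The compactness property of [((X, P), C, m)]. *)
Definition compactness_property (C : set (E -> \bar R))
    (m : {measure set (Borel E) -> \bar R}) : Prop :=
  forall u : nat -> E -> \bar R, (forall n, C (u n)) ->
    exists (Lambda : set R) (phi : nat -> nat),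
      [/\ Lambda `<=` [set a | (0 < a)%R],
          ereal_sup (EFin @` Lambda) = +oo,
          {homo phi : i j / (i < j)%N}
        & forall a, Lambda a ->
            \forall x \ae m, exists l : R,
              resolvent a (u (phi n)) x @[n --> \oo] --> l%:E].

End RightProcess.

Arguments B1 : clear implicits.

(** ** The metric space L^1 and order compactness

    The library's [LspaceType1 m] consists of the m-a.e. classes of real
    measurable functions with finite L^1 norm; it carries no topology there.
    [L1 m] is this type with the distance of the L^1 norm. *)

Definition L1 d (T : measurableType d) (R : realType)
  (m : {measure set T -> \bar R}) : Type := LspaceType1 m.

Section L1Metric.
Context d (T : measurableType d) (R : realType).
Variable m : {measure set T -> \bar R}.

Definition L1val (f : L1 m) : T -> R := f : LspaceType1 m.

HB.instance Definition _ := gen_eqMixin (L1 m).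
HB.instance Definition _ := gen_choiceMixin (L1 m).

Definition L1dist (f g : L1 m) : R :=
  fine ('N[m]_1[EFin \o (L1val f \- L1val g)%R]).

Lemma L1val_measurable (f : L1 m) : measurable_fun [set: T] (L1val f).
Proof.
exact: (@measurable_funPT _ _ _ _
  (repr (f : {mfun_ m, T >-> measurableTypeR R}))).
Qed.

Lemma L1val_integrable (f : L1 m) : m.-integrable [set: T] (EFin \o L1val f).
Proof.
apply/integrableP; split; first exact/measurable_EFinP/L1val_measurable.
by have := @Lebesgue_finite _ _ _ _ _ _ f; rewrite /finite_norm Lnorm1.
Qed.

Lemma L1dist_integrable (f g : L1 m) :
  m.-integrable [set: T] (fun x => (L1val f x - L1val g x)%:E).
Proof.
rewrite (_ : (fun x => _) =
  (EFin \o L1val f) \- (EFin \o L1val g)); last by apply/funext => x.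
by apply: integrableB => //; exact: L1val_integrable.
Qed.

Lemma L1distE (f g : L1 m) :
  (L1dist f g)%:E = \int[m]_x `|(L1val f x - L1val g x)%:E|.
Proof.
rewrite /L1dist Lnorm1 fineK// ge0_fin_numE; last exact: integral_ge0.
by have /integrableP[] := L1dist_integrable f g.
Qed.

Lemma L1distxx (f : L1 m) : L1dist f f = 0%R.
Proof.
apply/EFin_inj; rewrite L1distE.
by under eq_integral do rewrite subrr abse0; rewrite integral0.
Qed.

Lemma L1val_ae_inj (f g : L1 m) : L1val f = L1val g %[ae m] -> f = g.
Proof.
move=> fg; have : (f : LspaceType1 m) = g :> {mfun_ m, T >-> measurableTypeR R}.
  by rewrite -[LHS]reprK -[RHS]reprK; apply/eqmodP/asboolP.
by case: f {fg} => f [[cf]]; case: g => g [[cg]] /= fg; move: cf cg;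
  rewrite fg => cf cg; rewrite (Prop_irrelevance cf cg).
Qed.

Lemma L1dist_eq0 (f g : L1 m) : L1dist f g = 0%R -> f = g.
Proof.
move=> fg; apply: L1val_ae_inj.
have /integrableP[mfg _] := L1dist_integrable f g.
have /ae_eq_integral_abs := mfg.
move=> /(_ m measurableT)[+ _]; rewrite -L1distE fg => /(_ erefl).
by apply: filterS => x /(_ I) [] /eqP; rewrite subr_eq0 => /eqP.
Qed.

Lemma L1dist_sym (f g : L1 m) : L1dist f g = L1dist g f.
Proof.
apply/EFin_inj; rewrite !L1distE; apply: eq_integral => x _ /=.
by rewrite distrC.
Qed.

Lemma L1dist_triangle (g f h : L1 m) :
  (L1dist f h <= L1dist f g + L1dist g h)%R.
Proof.
rewrite -lee_fin EFinD !L1distE.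
have ifg := integrable_abse (L1dist_integrable f g).
have igh := integrable_abse (L1dist_integrable g h).
have ifh := integrable_abse (L1dist_integrable f h).
rewrite -integralD//; apply: ge0_le_integral => //.
- by have /integrableP[] := ifh.
- by have /integrableP[] := integrableD measurableT ifg igh.
- by move=> x _ /=; rewrite lee_fin; exact: ler_distD.
Qed.

HB.instance Definition _ :=
  isMetric.Build R (L1 m) L1distxx L1dist_eq0 L1dist_sym L1dist_triangle.

End L1Metric.

Section OrderCompact.
Context (R : realType) (E : ptopologicalType).
Context (dO : measure_display) (Omega : measurableType dO).
Variables (X : R -> Omega -> option E) (P : E -> probability Omega R).
Variable m : {measure set (Borel E) -> \bar R}.

(** [order_interval v] is [[0, v]]; the order of L^1 is the m-a.e. one. *)
Definition order_interval (v : L1 m) : set (L1 m) :=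
  [set u | \forall x \ae m, (0 <= L1val u x <= L1val v x)%R].

(** The graph of the operator [resolvent a] on L^1: the function
    [resolvent X P a u] is a priori only universally measurable, so [w] is the
    class of a Borel version of it. *)
Definition resolvent_L1 (a : R) (u w : L1 m) : Prop :=
  \forall x \ae m, (L1val w x)%:E = resolvent X P a (EFin \o L1val u) x.

Definition order_compact (a : R) : Prop :=
  forall v : L1 m, (\forall x \ae m, (0 <= L1val v x)%R) ->
    precompact [set w | exists2 u, order_interval v u & resolvent_L1 a u w].

End OrderCompact.

(* Main.v *)
Require Import Defs.
From HB Require Import structures.
From mathcomp Require Import all_boot all_order all_algebra.
From mathcomp Require Import finmap.
From mathcomp Require Import all_classical all_reals all_analysis.
From mathcomp Require Import measurable_realfun.
From mathcomp Require Import lra ring.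

Set Implicit Arguments.
Unset Strict Implicit.
Unset Printing Implicit Defensive.

Import Order.TTheory GRing.Theory Num.Theory.
Import numFieldNormedType.Exports.
Import HBNNSimple.

Local Open Scope classical_set_scope.
Local Open Scope ring_scope.
Local Open Scope ereal_scope.

(** For bounded [u n], m-a.e. convergence of [R_a (u n)] at one rate [a] implies
    m-a.e. convergence at every rate [b]: use the resolvent equation
    [R_a = R_b + (b - a) R_b R_a], the excessiveness of [m] (which makes m-null
    sets null for the potential measures [R_b(x, .)] of m-almost every [x]) and
    dominated convergence.  Hence the set of rates in the compactness property
    can be replaced by any single rate.  Order compactness then follows by
    truncating the elements of [[0, v]] at the levels [k], extracting a diagonal
    subsequence, and dominating by [R_a v].  Conversely, order compactness is
    applied to [u n 1_(D k)], where the sets [D k] of finite measure increase to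
    [E], and the error is at most [R_a 1_(~` D k)], which tends to 0 everywhere.

    Since [R_a f] is only universally measurable, the resolvent equation is
    derived from Tonelli's theorem for the measure [\int V(dy) P_y] on the
    sample space, where [V = R_b(x, .)] is the potential measure. *)

(** * Integration of functions that are only almost everywhere measurable *)

(** Resolvents, semigroups and [x -> P x A] cannot enter Tonelli or the convergence theorems
    directly. Each is exchanged for a nonnegative Borel version with respect to the measure at hand;
    this leaves integrals unchanged. The resolvent equation is used at a fixed [x], always with the
    potential measure of the rate to be reached. Only convergence of the known resolvents almost
    everywhere for that finite measure is then required, and resolvents of functions in [B1] are
    uniformly bounded. Hence two forms of the equation, one for each order of the rates, both
    written as sums because the values may be infinite. Metrizability enters through joint
    measurability of the process in time and path, on which every use of Tonelli rests. *)

Section NonMeasurableIntegral.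
Context d (T : measurableType d) (R : realType).
Variable mu : {measure set T -> \bar R}.
Implicit Types f g : T -> \bar R.

(** A simple function below [f], cut to 0 on the null set [N], keeps its integral and lies below
    [g]. The supremum that defines the integral of [f] is therefore at most the one for [g]. *)
Lemma ge0_ae_eq_le_integral f g : (forall x, 0 <= f x) -> (forall x, 0 <= g x) ->
  (\forall x \ae mu, f x = g x) -> \int[mu]_x f x <= \int[mu]_x g x.
Proof.
move=> f0 g0 [N [mN muN fgN]].
rewrite !ge0_integralTE//; apply: ge_ereal_sup => _ [h /= hf <-].
have mNC : measurable (~` N) by exact: measurableC.
have -> : sintegral mu h = sintegral mu (proj_nnsfun h mNC).
  have := @integral_nnsfun _ _ _ mu setT measurableT h.
  have := @integral_nnsfun _ _ _ mu setT measurableT (proj_nnsfun h mNC).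
  rewrite !patch_setT => <- <-.
  apply: ae_eq_integral => //; first exact/measurable_EFinP.
    exact/measurable_EFinP.
  exists N; split => // x /= /not_implyP[_]; apply: contra_notP => Nx.
  by rewrite /= mindicE mem_set// mulr1.
apply: ereal_sup_ubound; exists (proj_nnsfun h mNC) => // x /=.
rewrite mindicE; have [|xN] := boolP (x \in ~` N); last by rewrite mulr0.
rewrite inE /= mulr1 => Nx; apply: le_trans (hf x) _.
by have -> : f x = g x by apply: contrapT => fg; apply/Nx/fgN.
Qed.

(* For a nonnegative function the library integral is a lower integral, so that
   no measurability is needed. *)
Lemma ae_eq_integral_nonmeasurable (D : set T) f g :
  {ae mu, forall x, D x -> f x = g x} ->
  \int[mu]_(x in D) f x = \int[mu]_(x in D) g x.
Proof.
move=> fg.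
have pos (f' g' : T -> \bar R) : (forall x, 0 <= f' x) -> (forall x, 0 <= g' x) ->
    (\forall x \ae mu, f' x = g' x) -> \int[mu]_x f' x = \int[mu]_x g' x.
  move=> f0 g0 fg'; apply/eqP; rewrite eq_le !ge0_ae_eq_le_integral//.
  by apply: filterS fg' => x ->.
rewrite integral_mkcond [RHS]integral_mkcond integralE [RHS]integralE.
have fgD : \forall x \ae mu, (f \_ D) x = (g \_ D) x.
  apply: filterS fg => x fgx; rewrite !patchE.
  by case: ifPn => //; rewrite inE => /fgx.
congr (_ - _); apply: pos => //.
  by apply: filterS fgD => x e; rewrite !funeposE e.
by apply: filterS fgD => x e; rewrite !funenegE e.
Qed.

End NonMeasurableIntegral.

(** * Measures obtained from monotone functionals *)

Section DaniellIntegral.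
Context d (T : measurableType d) (R : realType).
Variable Phi : (T -> \bar R) -> \bar R.
Hypothesis Phi_ge0 : forall f, (forall x, 0 <= f x) -> 0 <= Phi f.
Hypothesis PhiD : forall f g, measurable_fun setT f -> measurable_fun setT g ->
  (forall x, 0 <= f x) -> (forall x, 0 <= g x) -> Phi (f \+ g) = Phi f + Phi g.
Hypothesis PhiZ : forall (c : R) f, (0 <= c)%R -> measurable_fun setT f ->
  (forall x, 0 <= f x) -> Phi (fun x => c%:E * f x) = c%:E * Phi f.
Hypothesis Phi_cvg : forall f_ : nat -> T -> \bar R,
  (forall n, measurable_fun setT (f_ n)) -> (forall n x, 0 <= f_ n x) ->
  (forall x, nondecreasing_seq (f_ ^~ x)) ->
  Phi (fun x => limn (f_ ^~ x)) = limn (fun n => Phi (f_ n)).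

Let mu (A : set T) := Phi (EFin \o \1_A).

Let mfindic (A : set T) : measurable A ->
  measurable_fun setT (EFin \o (\1_A : T -> R)).
Proof. by move=> mA; apply/measurable_EFinP; exact: measurable_indic. Qed.

Let Phi0 : Phi (cst 0) = 0.
Proof.
have := @PhiZ 0%R (cst 0) (lexx _) (measurable_cst _) (fun=> lexx _).
by under eq_fun do rewrite mul0e; rewrite mul0e.
Qed.

Let Phi_sum (I : Type) (s : seq I) (f : I -> T -> \bar R) :
  (forall i, measurable_fun setT (f i)) -> (forall i x, 0 <= f i x) ->
  Phi (fun x => \sum_(i <- s) f i x) = \sum_(i <- s) Phi (f i).
Proof.
move=> mf f0; elim: s => [|i s IH].
  by rewrite big_nil -[RHS]Phi0; congr Phi; apply/funext => x; rewrite big_nil.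
rewrite big_cons -IH -PhiD//; first last.
- by move=> x; exact: sume_ge0.
- exact: emeasurable_sum.
by congr Phi; apply/funext => x; rewrite big_cons.
Qed.

Let mu0 : mu set0 = 0.
Proof.
rewrite /mu -[RHS]Phi0; congr Phi.
by apply/funext => x; rewrite /= indic0.
Qed.

Let mu_ge0 A : 0 <= mu A.
Proof. by apply: Phi_ge0 => x; rewrite lee_fin. Qed.

Let mu_sigma_additive : semi_sigma_additive mu.
Proof.
move=> F mF tF mUF.
have muE n : \sum_(0 <= i < n) mu (F i) =
    Phi (fun x => \sum_(0 <= i < n) (\1_(F i) x)%:E).
  rewrite (@Phi_sum _ _ (fun i => EFin \o \1_(F i)))//.
    by move=> i; exact: mfindic.
  by move=> i x; rewrite lee_fin.
have -> : mu (\bigcup_n F n) = limn (fun n => \sum_(0 <= i < n) mu (F i)).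
  rewrite (_ : (fun n => \sum_(0 <= i < n) mu (F i)) = fun n =>
    Phi (fun x => \sum_(0 <= i < n) (\1_(F i) x)%:E)); last first.
    by apply/funext => n; rewrite -muE.
  rewrite -(@Phi_cvg (fun n x => \sum_(0 <= i < n) (\1_(F i) x)%:E))//.
  - by congr Phi; apply/funext => x /=; rewrite indic_bigcup.
  - by move=> n; apply: emeasurable_sum => i; exact: mfindic.
  - by move=> n x; apply: sume_ge0 => i _; rewrite lee_fin.
  - by move=> x; apply: ereal_nondecreasing_series => n _ _; rewrite lee_fin.
apply: ereal_nondecreasing_is_cvgn.
by apply: ereal_nondecreasing_series => n _ _; exact: mu_ge0.
Qed.

HB.instance Definition _ :=
  isMeasure.Build _ _ _ mu mu0 mu_ge0 mu_sigma_additive.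

Let Phi_nnsfun (h : {nnsfun T >-> R}) :
  Phi (EFin \o h) = \int[mu]_x (h x)%:E.
Proof.
have hE : EFin \o h = fun x => \sum_(r <- fset_set (range h))
    (r * \1_(h @^-1` [set r]) x)%:E.
  apply/funext => x /=.
  by rewrite sumEFin fimfunE fsbig_finite.
rewrite [RHS](eq_integral (EFin \o h))// hE.
have mh r : measurable_fun setT (fun x => (r * \1_(h @^-1` [set r]) x)%:E).
  by apply/measurable_EFinP/measurable_funM.
have h0 r x : 0 <= (r * \1_(h @^-1` [set r]) x)%:E.
  exact: nnfun_muleindic_ge0.
rewrite Phi_sum// ge0_integral_sum//; apply: eq_bigr => r _.
rewrite integralZl_indic_nnsfun// integral_indic// setIT.
(* The sum ranges over all values [r], and homogeneity is available for [0 <= r] only; for negative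
   [r] the level set is empty. *)
have [r0|r0] := ltP r 0%R.
  by rewrite preimage_nnfun0// indic0 measure0 mule0;
     under eq_fun do rewrite mulr0; exact: Phi0.
under eq_fun do rewrite EFinM.
by rewrite PhiZ//; exact: mfindic.
Qed.

(** The measure is [Phi] on indicators: linearity settles simple functions, continuity along
    increasing sequences the rest. It yields both the mixtures of the [P x] and the potential
    measures. *)
Lemma Daniell_representation : Phi (cst 1) < +oo ->
  exists nu : {finite_measure set T -> \bar R},
    forall f, measurable_fun setT f -> (forall x, 0 <= f x) ->
      Phi f = \int[nu]_x f x.
Proof.
move=> Phi1.
have muT : mu setT < +oo.
  rewrite /mu (_ : EFin \o _ = cst 1)//.
  by apply/funext => x /=; rewrite indicT.
exists (mfrestr measurableT muT) => f mf f0.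
pose f_ := nnsfun_approx measurableT mf.
have f_f x : limn (fun n => (f_ n x)%:E) = f x.
  by apply/cvg_lim => //; apply: cvg_nnsfun_approx => // y _; exact: f0.
have ndf x : nondecreasing_seq (fun n => (f_ n x)%:E).
  by move=> m n mn; rewrite lee_fin; exact/lefP/nd_nnsfun_approx.
have mf_ n : measurable_fun setT (EFin \o f_ n) by exact/measurable_EFinP.
transitivity (limn (fun n => \int[mu]_x (f_ n x)%:E)).
  rewrite (_ : f = fun x => limn (fun n => (f_ n x)%:E)); last first.
    by apply/funext => x; rewrite f_f.
  rewrite (Phi_cvg mf_)//; last by move=> n x; rewrite lee_fin.
  by congr (limn _); apply/funext => n; exact: Phi_nnsfun.
rewrite -monotone_convergence//.
- rewrite (eq_integral f); last by move=> x _; exact: f_f.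
  by apply: eq_measure_integral => A mA _; rewrite /= /mfrestr /mrestr setIT.
- by move=> n x _; rewrite lee_fin.
Qed.

End DaniellIntegral.

(** * Borel versions of universally measurable functions *)

Section UniversallyMeasurable.
Context d (T : measurableType d) (R : realType).

(** Universal measurability tests finite measures only, so it is applied to the restriction of [mu]
    to each finite piece [F i], and the inner sets are glued along the pieces. *)
Lemma univ_measurable_ae (mu : {sigma_finite_measure set T -> \bar R})
    (A : set T) : univ_measurable R A ->
  exists B, [/\ measurable B, B `<=` A & mu.-negligible (A `\` B)].
Proof.
move=> uA; have [F TF /all_and2[mF muF]] := sigma_finiteT mu.
have [B /(_ _)/cid BP] := choice (fun i => uA (mfrestr (mF i) (muF i))).
exists (\bigcup_i (B i `&` F i)); split.
- by apply: bigcupT_measurable => i; apply: measurableI => //;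
    have [C []] := BP i.
- by move=> x [i _ [Bix _]]; have [C [_ _ + _ _]] := BP i; exact.
have : mu.-negligible (\bigcup_i ((sval (BP i) `\` B i) `&` F i)).
  apply: negligible_bigcup => i; case: (BP i) => C [mB mC BA AC CB0] /=.
  by apply/negligibleP => //; apply: measurableI => //; exact: measurableD.
apply: negligibleS => x [Ax nBx].
have [i _ Fix_] : (\bigcup_i F i) x by rewrite -TF.
exists i => //; split => //; case: (BP i) => C [mB mC BA AC CB0] /=.
by split; [exact: AC|move=> Bix; apply: nBx; exists i].
Qed.

Definition ae_measurable (mu : {measure set T -> \bar R}) (h : T -> \bar R) :=
  exists g, [/\ measurable_fun setT g, forall x, 0 <= g x &
    \forall x \ae mu, h x = g x].

(** [h] is the supremum of [q] times the indicator of [h > q] over rational [q]. Shrinking each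
    superlevel set to a measurable [B n] gives a measurable function below [h]; where it is strictly
    below, a rational in the gap puts the point in the null set [S n] minus [B n]. *)
Lemma univ_measurable_fun_ae (mu : {sigma_finite_measure set T -> \bar R})
    (h : T -> \bar R) :
  (forall x, 0 <= h x) -> univ_measurable_fun h -> ae_measurable mu h.
Proof.
move=> h0 uh.
(* An enumeration of the rationals; a number that codes none is sent to 0, which only repeats a
   value. *)
pose q (n : nat) : R := ratr (odflt (0%R : rat) (choice.unpickle n)).
pose S n := [set x | (q n)%:E < h x].
have uS n : univ_measurable R (S n).
  rewrite (_ : S n = h @^-1` `](q n)%:E, +oo]); last first.
    by apply/seteqP; split => x /=; rewrite in_itv/= ?leey ?andbT// => /andP[].
  exact/uh/emeasurable_itv.
have [B /all_and3[mB BS SB]] := choice (fun n => univ_measurable_ae mu (uS n)).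
pose f n x : \bar R := if x \in B n then (Num.max (q n) 0)%:E else 0.
have mf n : measurable_fun setT (f n).
  apply: measurable_fun_ifT => //.
  by apply: (measurable_fun_bool true); rewrite setTI preimage_mem_true.
have f0 n x : 0 <= f n x.
  by rewrite /f; case: ifP => // _; rewrite lee_fin le_max lexx orbT.
have fh n x : f n x <= h x.
  rewrite /f; case: ifPn => // /[!inE] /BS /ltW hq.
  by rewrite EFin_max ge_max hq h0.
have flub n x : f n x <= esups (f ^~ x) 0%N.
  by apply: ereal_sup_ubound; exists n.
exists (fun x => esups (f ^~ x) 0%N); split.
- exact: measurable_fun_esups.
- by move=> x; apply: le_trans (flub 0%N x); exact: f0.
have : mu.-negligible (\bigcup_n (S n `\` B n)) by exact: negligible_bigcup.
apply: negligibleS => x /=; apply: contra_notP => nx.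
apply/eqP; rewrite eq_le; apply/andP; split; last first.
  by apply: ge_ereal_sup => _ [n _ <-]; exact: fh.
rewrite leNgt; apply/negP => lth.
have [r [fr rh]] : exists r : rat, esups (f ^~ x) 0%N < (ratr r)%:E /\ (ratr r)%:E < h x.
  have s0 : 0 <= esups (f ^~ x) 0%N by apply: le_trans (flub 0%N x); exact: f0.
  move: s0 lth; case: (esups _ _) => // [s _|_]; last by rewrite ltNge leey.
  case: (h x) => // [t|_].
    rewrite lte_fin => /rat_in_itvoo[r].
    by rewrite in_itv/= => /andP[sr rt]; exists r; rewrite !lte_fin.
  have /rat_in_itvoo[r] : (s < s + 1)%R by rewrite ltrDl.
  by rewrite in_itv/= => /andP[sr _]; exists r; rewrite lte_fin ltry.
have qE : q (choice.pickle r) = ratr r by rewrite /q choice.pickleK.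
apply: nx; exists (choice.pickle r) => //; split; first by rewrite /S/= qE.
move=> Bx; have := le_lt_trans (flub (choice.pickle r) x) fr.
by rewrite /f mem_set// qE lte_fin gt_max ltxx.
Qed.

Lemma measurable_ae_measurable (mu : {measure set T -> \bar R}) h :
  measurable_fun setT h -> (forall x, 0 <= h x) -> ae_measurable mu h.
Proof. by move=> mh h0; exists h; split => //; exact: aeW. Qed.

Lemma ae_measurable_sum (mu : {measure set T -> \bar R}) (I : Type) (s : seq I)
    (h : I -> T -> \bar R) : (forall i, ae_measurable mu (h i)) ->
  ae_measurable mu (fun x => \sum_(i <- s) h i x).
Proof.
move=> mh; elim: s => [|i s [g [mg g0 hg]]].
  by exists (cst 0); split => //; apply: aeW => x; rewrite big_nil.
have [f [mf f0 hf]] := mh i; exists (f \+ g); split.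
- exact: emeasurable_funD.
- by move=> x; rewrite adde_ge0.
- by apply: filterS2 hf hg => x hf hg; rewrite big_cons hf hg.
Qed.

Lemma ae_measurableZ (mu : {measure set T -> \bar R}) (c : R) h : (0 <= c)%R ->
  ae_measurable mu h -> ae_measurable mu (fun x => c%:E * h x).
Proof.
move=> c0 [g [mg g0 hg]]; exists (fun x => c%:E * g x); split.
- exact: measurable_funeM.
- by move=> x; rewrite mule_ge0.
- by apply: filterS hg => x ->.
Qed.

Lemma ae_measurable_cvg (mu : {measure set T -> \bar R})
    (h_ : nat -> T -> \bar R) h : (forall n, ae_measurable mu (h_ n)) ->
  (forall x, h_ n x @[n --> \oo] --> h x) -> ae_measurable mu h.
Proof.
move=> /choice[g /all_and3[mg g0 hg]] h_h.
(* The upper limit is measurable whether or not [g n x] converges, and the maximum with 0 gives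
   nonnegativity at every point. *)
exists (fun x => maxe 0 (limn_esup (g ^~ x))); split.
- by apply: measurable_maxe => //; exact: measurable_fun_limn_esup.
- by move=> x; rewrite le_max lexx.
apply: filterS (ae_foralln hg) => x hgx.
have gh : g n x @[n --> \oo] --> h x.
  by under eq_fun do rewrite -hgx; exact: h_h.
have -> : limn_esup (g ^~ x) = h x.
  by rewrite is_cvg_limn_esupE; [exact/cvg_lim|apply/cvg_ex; exists (h x)].
apply/esym/max_idPr.
have <- : limn (g ^~ x) = h x by exact/cvg_lim.
by apply: lime_ge; [apply/cvg_ex; exists (h x)|exact: nearW].
Qed.

(** The versions [g n] may fail to increase in [n] on a null set. Putting them to 0 on one null set
    [N] common to all [n] makes them increase everywhere. *)
Lemma ae_measurable_monotone_convergence (mu : {measure set T -> \bar R})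
    (h_ : nat -> T -> \bar R) : (forall n, ae_measurable mu (h_ n)) ->
  (forall n x, 0 <= h_ n x) -> (forall x, nondecreasing_seq (h_ ^~ x)) ->
  \int[mu]_x limn (h_ ^~ x) = limn (fun n => \int[mu]_x h_ n x).
Proof.
move=> /choice[g /all_and3[mg g0 hg]] h0 ndh.
have [N [mN N0 hgN]] := ae_foralln hg.
pose g' n := g n \_ (~` N).
have hg' x : ~ N x -> forall n, h_ n x = g' n x.
  move=> nNx n; rewrite /g' patchE mem_set//.
  by move: n; apply: contrapT => /hgN.
have aeN (f1 f2 : T -> \bar R) : (forall x, ~ N x -> f1 x = f2 x) ->
    \int[mu]_x f1 x = \int[mu]_x f2 x.
  move=> f12; apply: ae_eq_integral_nonmeasurable; exists N; split => // x /=.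
  by move=> /not_implyP[_]; apply: contra_notP => /f12.
transitivity (\int[mu]_x limn (g' ^~ x)).
  by apply: aeN => x /hg' hx; congr (limn _); apply/funext => n.
rewrite monotone_convergence//.
- by congr (limn _); apply/funext => n; apply: aeN => x /hg' ->.
- move=> n; apply/(measurable_restrictT _ _).1; first exact: measurableC.
  exact: measurable_funTS.
- by move=> n x _; apply: erestrict_ge0.
- move=> x _ m n mn; have [Nx|Nx] := pselect (N x).
    by rewrite /g' !patchE memNset//=; exact.
  by rewrite -!hg'//; exact: ndh.
Qed.

End UniversallyMeasurable.

(** * Integration against a universally measurable kernel *)

Section Kernel.
Context d (T : measurableType d) dO (Omega : measurableType dO) (R : realType).
Variable P : T -> probability Omega R.
Hypothesis uP : forall A : set Omega, measurable A ->
  univ_measurable_fun (fun x => P x A).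

Lemma ae_measurable_kernel_integral
    (mu : {sigma_finite_measure set T -> \bar R}) (G : Omega -> \bar R) :
  measurable_fun setT G -> (forall w, 0 <= G w) ->
  ae_measurable mu (fun x => \int[P x]_w G w).
Proof.
move=> mG G0; pose g := nnsfun_approx measurableT mG.
apply: (@ae_measurable_cvg _ _ _ _ (fun n x => \int[P x]_w (g n w)%:E)).
  move=> n; under eq_fun do
    rewrite integral_nnsfun// patch_setT sintegralE fsbig_finite//=.
  apply: ae_measurable_sum => r.
  have mr : measurable (g n @^-1` [set r]) by [].
  have [r0|r0] := ltP r 0%R.
    under eq_fun do rewrite preimage_nnfun0// measure0 mule0.
    exact: measurable_ae_measurable.
  apply: ae_measurableZ => //; apply: univ_measurable_fun_ae => //.
  exact: uP.
move=> x; rewrite (eq_integral (fun w => limn (fun n => (g n w)%:E))).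
  apply: cvg_monotone_convergence => //.
  - by move=> n; exact/measurable_EFinP.
  - by move=> n w _; rewrite lee_fin.
  - by move=> w _ m n mn; rewrite lee_fin; exact/lefP/nd_nnsfun_approx.
by move=> w _; apply/esym/cvg_lim => //; apply: cvg_nnsfun_approx.
Qed.

(** [M] is the law of the process started from [nu]. As a genuine measure on [Omega] it is open to
    Tonelli, which the iterated integral is not. *)
Lemma mixture_measure (nu : {finite_measure set T -> \bar R}) :
  exists M : {finite_measure set Omega -> \bar R},
    forall G, measurable_fun setT G -> (forall w, 0 <= G w) ->
      \int[nu]_x \int[P x]_w G w = \int[M]_w G w.
Proof.
apply: (Daniell_representation (Phi := fun G => \int[nu]_x \int[P x]_w G w)).
- by move=> G G0; apply: integral_ge0 => x _; exact: integral_ge0.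
- move=> G H mG mH G0 H0.
  have [g [mg g0 Gg]] := ae_measurable_kernel_integral nu mG G0.
  have [h [mh h0 Hh]] := ae_measurable_kernel_integral nu mH H0.
  rewrite (@ae_eq_integral_nonmeasurable _ _ _ _ _ _ (g \+ h)).
    by rewrite ge0_integralD//; congr (_ + _);
      apply/esym/ae_eq_integral_nonmeasurable; [apply: filterS Gg|apply: filterS Hh].
  by apply: filterS2 Gg Hh => x <- <- _; rewrite ge0_integralD.
- move=> c G c0 mG G0.
  have [g [mg g0 Gg]] := ae_measurable_kernel_integral nu mG G0.
  rewrite (@ae_eq_integral_nonmeasurable _ _ _ _ _ _ (fun x => c%:E * g x)).
    by rewrite ge0_integralZl_EFin//; congr (_ * _);
      apply/esym/ae_eq_integral_nonmeasurable; apply: filterS Gg.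
  by apply: filterS Gg => x <- _; rewrite ge0_integralZl_EFin.
- move=> G_ mG G0 ndG.
  rewrite -ae_measurable_monotone_convergence//.
  + by apply: eq_integral => x _; rewrite monotone_convergence// => w _; exact: ndG.
  + by move=> n; exact: ae_measurable_kernel_integral.
  + by move=> n x; exact: integral_ge0.
  + move=> x m n mn; apply: ge0_le_integral => // w _; exact: ndG.
- rewrite (eq_integral (cst 1)); last first.
    by move=> x _; rewrite integral_cst//= mul1e probability_setT.
  by rewrite integral_cst//= mul1e ltey_eq fin_num_measure.
Qed.

End Kernel.

(** * The resolvent equation for Laplace transforms *)

Section LaplaceResolvent.
Context {R : realType}.
Notation mu := (@lebesgue_measure R).
Implicit Types (a b c r s t : R) (phi : R -> \bar R).

Lemma ge0_integral_translation (g : R -> \bar R) c : measurable_fun setT g ->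
  (forall x, 0 <= g x) -> \int[mu]_x g (x + c)%R = \int[mu]_x g x.
Proof.
move=> mg g0.
pose tr : measurableTypeR R -> measurableTypeR R := fun x => (x + c)%R.
have mtr : measurable_fun setT tr by exact: measurable_funD.
have muE A : measurable A -> pushforward mu tr A = mu A.
  move=> mA; apply/esym/lebesgue_measure_unique => //= _ [[u v]] _ <- /=.
  rewrite /pushforward (_ : tr @^-1` `]u, v] = `](u - c)%R, (v - c)%R]%classic).
    rewrite !lebesgue_measure_itv/= !lte_fin ltrD2r.
    by case: ifP => // _; congr (_%:E); lra.
  by apply/seteqP; split => x; rewrite /tr /= !in_itv/= ltrBlDr lerBrDr.
transitivity (\int[pushforward mu tr]_x g x).
  by rewrite (@ge0_integral_pushforward _ _ _ _ _ _ mtr)//= => x _.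
by apply: eq_measure_integral => A mA _; exact: muE.
Qed.

(** Extending by 0 to negative times lets translations and convolutions run over the whole line. *)
Definition discount c : R -> R := (fun t => expR (- (c * t))) \_ `[0%R, +oo[.

Lemma discount_ge0 c t : (0 <= discount c t)%R.
Proof. by rewrite /discount patchE; case: ifP => // _; exact: expR_ge0. Qed.

Lemma measurable_discount c : measurable_fun setT (discount c).
Proof.
apply/(measurable_restrictT _ _).1 => //.
by apply: measurableT_comp => //; apply: measurableT_comp => //; exact: measurable_funM.
Qed.

Lemma measurable_EFin_discount c : measurable_fun setT (EFin \o discount c).
Proof. by apply/measurable_EFinP; exact: measurable_discount. Qed.

Lemma integral_discountE c phi :
  \int[mu]_(t in `[0%R, +oo[) ((expR (- (c * t)))%:E * phi t) =
  \int[mu]_t ((discount c t)%:E * phi t).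
Proof.
rewrite integral_mkcond; apply: eq_integral => t _.
by rewrite /discount !patchE; case: ifP => // _; rewrite mul0e.
Qed.

Lemma integral_discount_lty c : (0 < c)%R -> \int[mu]_t (discount c t)%:E < +oo.
Proof.
move=> c0.
have mexp : measurable_fun setT (EFin \o exponential_pdf c).
  by apply/measurable_EFinP; exact: measurable_exponential_pdf.
have -> : \int[mu]_t (discount c t)%:E =
    \int[mu]_t ((c^-1)%:E * (exponential_pdf c t)%:E).
  apply: eq_integral => t _; rewrite /discount /exponential_pdf !patchE -EFinM.
  by case: ifP => _; rewrite ?mulr0// mulrA mulVf ?gt_eqF// mul1r mulNr.
rewrite ge0_integralZl_EFin//; last by rewrite invr_ge0 ltW.
- by rewrite integral_exponential_pdf// mule1 ltry.
- by move=> t _; rewrite lee_fin exponential_pdf_ge0// ltW.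
Qed.

Local Notation k := discount.
Let k_ge0 := discount_ge0.
Let measurable_k := measurable_discount.
Let mEk := measurable_EFin_discount.
Let kE := integral_discountE.
#[local] Hint Resolve k_ge0 measurable_k : core.

(** The kernel identity behind the resolvent equation. For [0 <= r] the convolution is [e^(-ar)]
    times the integral of [e^(-(b-a)s)] over [[0, r]], and [b - a] times that integral is the
    probability of [[0, r]] under the exponential law of rate [b - a]. *)
Let k_convolution a b r : (a < b)%R ->
  (b - a)%:E * \int[mu]_s ((k b s)%:E * (k a (r - s))%:E) = (k a r - k b r)%:E.
Proof.
move=> ab; have [r0|r0] := ltP r 0%R.
  rewrite integral0_eq ?mule0; last first.
    move=> s _; rewrite /discount !patchE; case: ifPn => [|_]; last by rewrite mul0e.
    rewrite !inE/= !in_itv/= !andbT => s0.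
    rewrite memNset ?mule0//= in_itv/= andbT subr_ge0.
    by apply/negP; rewrite -ltNge (lt_le_trans r0).
  rewrite /discount !patchE memNset ?subrr//= in_itv/= andbT.
  by apply/negP; rewrite -ltNge.
have -> : \int[mu]_s ((k b s)%:E * (k a (r - s))%:E) =
    \int[mu]_(s in `[0%R, r]) ((expR (- (a * r)))%:E * (expR (- (b - a) * s))%:E).
  rewrite [RHS]integral_mkcond; apply: eq_integral => s _.
  rewrite /discount !patchE !mem_setE !in_itv/= !andbT subr_ge0.
  case: (leP 0%R s) => s0; last by rewrite mul0e.
  case: (leP s r) => sr /=; last by rewrite mule0.
  by rewrite -!EFinM -!expRD; congr (expR _)%:E; ring.
have mexp : measurable_fun `[0%R, r] (fun s => (expR (- (b - a) * s))%:E).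
  exact/measurable_funTS/measurable_EFinP/measurableT_comp.
rewrite ge0_integralZl_EFin ?expR_ge0//.
rewrite muleCA -ge0_integralZl_EFin//; last by rewrite subr_ge0 ltW.
have -> : \int[mu]_(s in `[0%R, r]) ((b - a)%:E * (expR (- (b - a) * s))%:E) =
    exponential_prob (b - a) `[0%R, r].
  apply: eq_integral => s; rewrite inE/= in_itv/= => /andP[s0 _].
  by rewrite exponential_pdfE// -EFinM.
have -> : exponential_prob (b - a) `[0%R, r] = (1 - expR (- (b - a) * r))%:E.
  move: r0; rewrite le_eqVlt => /predU1P[<-|r0].
    by rewrite mulr0 expR0 subrr set_itv1 /exponential_prob integral_set1.
  by rewrite exponential_prob_itv0c// EFinB.
rewrite -EFinM /discount !patchE !mem_setE !in_itv/= r0 /=; congr EFin.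
by rewrite mulrBr mulr1 -expRD; congr (_ - expR _)%R; ring.
Qed.

Variables (phi : R -> \bar R) (mphi : measurable_fun setT phi).
Hypothesis phi_ge0 : forall t, 0 <= phi t.

Let laplace c psi := \int[mu]_(t in `[0%R, +oo[) ((expR (- (c * t)))%:E * psi t).

(** Substituting [r = t + s] and applying Tonelli turns the double transform into the integral of
    [phi r] against the convolution of the two kernels, which [k_convolution] evaluates. *)
Lemma laplace_resolvent a b : (a < b)%R ->
  laplace a phi =
  laplace b phi + (b - a)%:E * laplace b (fun s => laplace a (fun t => phi (t + s)%R)).
Proof.
move=> ab; rewrite /laplace.
have mk2 (c : R) : measurable_fun setT (fun p : measurableTypeR R * measurableTypeR R =>
    (k c (p.2 - p.1))%:E).
  apply/measurable_EFinP; apply: measurableT_comp => //.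
  exact: measurable_funB.
pose F (p : measurableTypeR R * measurableTypeR R) :=
  (k b p.1)%:E * ((k a (p.2 - p.1))%:E * phi p.2).
have mF : measurable_fun setT F.
  apply: emeasurable_funM; first exact: (measurableT_comp (mEk b) measurable_fst).
  by apply: emeasurable_funM; [exact: mk2|exact: (measurableT_comp mphi measurable_snd)].
have F0 p : 0 <= F p by rewrite !mule_ge0 ?lee_fin.
have inner s : \int[mu]_(t in `[0%R, +oo[) ((expR (- (a * t)))%:E * phi (t + s)%R)
    = \int[mu]_r ((k a (r - s))%:E * phi r).
  rewrite kE -(@ge0_integral_translation (fun r => (k a (r - s))%:E * phi r) s).
  - by apply: eq_integral => t _; rewrite addrK.
  - apply: emeasurable_funM => //; apply/measurable_EFinP.
    by apply: measurableT_comp => //; exact: measurable_funB.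
  - by move=> r; rewrite mule_ge0 ?lee_fin.
under [X in _ = _ + _ * X]eq_integral do rewrite inner.
rewrite !kE.
have -> : \int[mu]_s ((k b s)%:E * \int[mu]_r ((k a (r - s))%:E * phi r)) =
    \int[mu]_s \int[mu]_r F (s, r).
  apply: eq_integral => s _; rewrite -ge0_integralZl_EFin//.
  - by move=> r _; rewrite mule_ge0 ?lee_fin.
  - apply: emeasurable_funM => //; apply/measurable_EFinP.
    by apply: measurableT_comp => //; exact: measurable_funB.
rewrite (fubini_tonelli F)// -ge0_integralZl_EFin//; first last.
- by rewrite subr_ge0 ltW.
- exact: measurable_fun_fubini_tonelli_G.
- by move=> r _; exact: integral_ge0.
rewrite -ge0_integralD//; first last.
- by apply: measurable_funeM; exact: measurable_fun_fubini_tonelli_G.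
- move=> r _; apply: mule_ge0; first by rewrite lee_fin subr_ge0 ltW.
  exact: integral_ge0.
- exact: (emeasurable_funM (mEk b) mphi).
- by move=> r _; rewrite mule_ge0 ?lee_fin.
apply: eq_integral => r _.
have -> : \int[mu]_s F (s, r) =
    phi r * \int[mu]_s ((k b s)%:E * (k a (r - s))%:E).
  rewrite -ge0_integralZl//.
  - by apply: eq_integral => s _; rewrite /F/= muleA muleC.
  - apply: emeasurable_funM; first exact: mEk.
    apply/measurable_EFinP; apply: measurableT_comp => //.
    exact: measurable_funB.
  - by move=> s _; rewrite mule_ge0 ?lee_fin.
(* Distributivity over a sum of extended reals needs both coefficients nonnegative. *)
have kab : (0 <= k a r - k b r)%R.
  rewrite -lee_fin -k_convolution//.
  apply: mule_ge0; first by rewrite lee_fin subr_ge0 ltW.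
  by apply: integral_ge0 => s _; rewrite mule_ge0 ?lee_fin.
rewrite muleCA k_convolution// (muleC (phi r)) -ge0_muleDl ?lee_fin//.
by rewrite -EFinD subrKC.
Qed.

(** Commutation of the resolvents at the level of transforms: [phi (t + s)] is symmetric in the two
    times. *)
Lemma laplace_laplace_sym a b :
  laplace b (fun s => laplace a (fun t => phi (t + s)%R)) =
  laplace a (fun s => laplace b (fun t => phi (t + s)%R)).
Proof.
pose F (p : measurableTypeR R * measurableTypeR R) :=
  (k b p.1)%:E * ((k a p.2)%:E * phi (p.2 + p.1)%R).
have mF : measurable_fun setT F.
  apply: emeasurable_funM; first exact: (measurableT_comp (mEk b) measurable_fst).
  apply: emeasurable_funM; first exact: (measurableT_comp (mEk a) measurable_snd).
  by apply: (measurableT_comp mphi); exact: measurable_funD.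
have F0 p : 0 <= F p by rewrite !mule_ge0 ?lee_fin.
have mphis s : measurable_fun setT (fun t => phi (t + s)%R).
  by apply: measurableT_comp => //; exact: measurable_funD.
have pull c c' s : (k c s)%:E * \int[mu]_t ((k c' t)%:E * phi (t + s)%R) =
    \int[mu]_t ((k c s)%:E * ((k c' t)%:E * phi (t + s)%R)).
  rewrite ge0_integralZl_EFin//.
  - by move=> t _; rewrite mule_ge0 ?lee_fin.
  - exact: (emeasurable_funM (mEk c') (mphis s)).
rewrite /laplace !kE.
transitivity (\int[mu]_s \int[mu]_t F (s, t)).
  by apply: eq_integral => s _; rewrite kE pull.
rewrite (fubini_tonelli F)//; apply: eq_integral => s _.
rewrite kE pull; apply: eq_integral => t _.
by rewrite /F/= muleCA addrC.
Qed.

End LaplaceResolvent.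

(** * Potential measures of a right process *)

Section RightProcessMeasurability.
Context (R : realType) (E : ptopologicalType).
Hypothesis radonE : radon_metrizable R E.

Lemma radon_metrizable_open_exhaustion (U : set E) : open U ->
  exists V F : nat -> set E, [/\ forall k, open (V k), forall k, closed (F k),
    forall k, V k `<=` F k, forall k, F k `<=` U & U `<=` \bigcup_k V k].
Proof.
have [K [j [_ _ _ openE _]]] := radonE => /openE[W oW ->].
(* A point of the closure of [A k] lies within [1/(k+1)] of some point of [A k], hence still in [W].
   This yields closed sets [F k] inside [U] whose inner open sets [V k] exhaust it. *)
pose A k := [set y | ball y (k.+1%:R^-1 : R) `<=` W].
exists (fun k => j @^-1` (A k)^°), (fun k => j @^-1` closure (A k)).
have pos k : (0 < k.+1%:R^-1 :> R)%R by rewrite invr_gt0 ltr0Sn.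
split.
- by move=> k; apply/openE; exists (A k)^° => //; exact: open_interior.
- move=> k; rewrite -[X in closed X]setCK; apply/open_closedC/openE.
  by exists (~` closure (A k)) => //; apply/closed_openC/closed_closure.
- by move=> k x /= /interior_subset; exact: subset_closure.
- move=> k x /= /(_ _ (nbhsx_ballx (j x) _ (pos k)))[y [Ay /ball_sym xy]].
  exact: Ay.
- move=> x /= Wjx; have /nbhs_ballP[e /= e0 eW] : nbhs (j x) W.
    exact: open_nbhs_nbhs.
  have [k ke] : exists k : nat, (k.+1%:R^-1 + k.+1%:R^-1 < e)%R.
    have [k _ /(_ k (leqnn k)) /=] := near_infty_natSinv_lt (PosNum (divr_gt0 e0 (ltr0Sn _ 1))).
    by move=> ke; exists k; rewrite [ltRHS]splitr ltrD.
  exists k => //=; apply/nbhs_ballP; exists k.+1%:R^-1%R; first exact: pos.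
  move=> y xy z yz.
  by apply: eW; apply: le_ball (ltW ke) _ _; exact: ball_triangle xy yz.
Qed.

Lemma measurable_oapp d (T : measurableType d) (Y : T -> option E)
    (f : Borel E -> \bar R) :
  (forall B : set (Borel E), measurable B -> measurable (Y @^-1` (Some @` B))) ->
  measurable_fun setT f -> measurable_fun setT (fun p => oapp f 0 (Y p)).
Proof.
move=> mY mf _ S mS; rewrite setTI.
have mfS : measurable (f @^-1` S) by rewrite -[_ @^-1` _]setTI; exact: mf.
have mN : measurable (~` (Y @^-1` (Some @` [set: E]))).
  by apply: measurableC; exact: (mY setT).
(* The cemetery is sent to 0, so it belongs to the preimage exactly when [S] contains 0. *)
have [S0|S0] := pselect (S 0).
  rewrite [X in measurable X](_ : _ =
      Y @^-1` (Some @` (f @^-1` S)) `|` ~` (Y @^-1` (Some @` [set: E]))).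
    by apply: measurableU => //; exact: mY.
  apply/seteqP; split => p /=; case: (Y p) => [x|] //=.
  - by move=> Sfx; left; exists x.
  - by move=> _; right => -[].
  - by move=> [[y Sy [<-]]//|]; case; exists x.
rewrite [X in measurable X](_ : _ = Y @^-1` (Some @` (f @^-1` S))).
  exact: mY.
apply/seteqP; split => p /=; case: (Y p) => [x|] //=.
- by move=> Sfx; exists x.
- by move=> [y Sy [<-]].
- by move=> [].
Qed.

Context (dO : measure_display) (Omega : measurableType dO).
Variables (X : R -> Omega -> option E) (P : E -> probability Omega R).
Hypothesis rightX : right_process X P.

(** For [0 <= t], the first multiple of [1/(n+1)] strictly after [t]. Strictness matters because
    right continuity is stated on punctured right neighbourhoods. *)
Let tn n (t : R) : R := ((Num.truncn (t * n.+1%:R)).+1%:R / n.+1%:R)%R.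

Let tn_gt n t : (0 <= t -> t < tn n t)%R.
Proof. by move=> t0; rewrite /tn ltr_pdivlMr// truncnS_gt. Qed.

Let tn_le n t : (0 <= t -> tn n t <= t + n.+1%:R^-1)%R.
Proof.
move=> t0; rewrite /tn ler_pdivrMr// mulrDl mulVf// -natr1 lerD2r.
by rewrite truncn_le// mulr_ge0.
Qed.

Let measurable_tn n i :
  measurable [set t : measurableTypeR R | Num.truncn (`|t| * n.+1%:R)%R = i].
Proof.
have mf : measurable_fun setT (fun t : measurableTypeR R => `|t| * n.+1%:R)%R.
  by apply: measurable_funM => //; exact: measurableT_comp.
have := mf measurableT `[i%:R, i.+1%:R[%classic (measurable_itv _).
rewrite setTI; congr measurable; apply/seteqP; split => t /=; rewrite in_itv/=.
  by move=> /truncn_def.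
move=> <-; have t0 : (0 <= `|t| * n.+1%:R :> R)%R by rewrite mulr_ge0.
exact: truncn_itv.
Qed.

(* Right continuity: the path is in [U] at time [t] iff it is eventually in one
   of the closed sets [F k] at the times [tn n t] decreasing to [t]. *)
Lemma measurable_right_process (B : set (Borel E)) : measurable B ->
  measurable [set p : measurableTypeR R * Omega | (Some @` B) (X `|p.1| p.2)].
Proof.
(* The absolute value makes every real a legitimate time, as [X] is controlled at nonnegative times
   only. *)
pose Y (p : measurableTypeR R * Omega) := X `|p.1| p.2.
have oY (U : set E) : open U -> measurable (Y @^-1` (Some @` U)).
  move=> /radon_metrizable_open_exhaustion[V [F [oV cF VF FU UV]]].
  pose S k n := [set p : measurableTypeR R * Omega |
    (Some @` F k) (X (tn n `|p.1|) p.2)].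
  have mS k n : measurable (S k n).
    rewrite (_ : S k n = \bigcup_i
        ([set t : measurableTypeR R | Num.truncn (`|t| * n.+1%:R)%R = i] `*`
         (X (i.+1%:R / n.+1%:R)%R @^-1` (Some @` F k)))).
      apply: bigcupT_measurable => i; apply: measurableX => //.
      apply: (rp_measurable rightX); first by rewrite divr_ge0.
      rewrite -[F k]setCK; apply: measurableC; apply: sub_sigma_algebra.
      exact: closed_openC.
    apply/seteqP; split => [p Sp|p [i _ [/= <-]]//].
    by exists (Num.truncn (`|p.1| * n.+1%:R)%R).
  rewrite (_ : _ @^-1` _ = \bigcup_k \bigcup_N \bigcap_(n in [set n | (N <= n)%N]) S k n).
    apply: bigcupT_measurable => k; apply: bigcupT_measurable => N.
    by apply: bigcap_measurable => //; exists N => /=.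
  have ev t w x (W : set E) : (0 <= t)%R -> X t w = Some x -> open W -> W x ->
      exists N, forall n, (N <= n)%N -> (Some @` W) (X (tn n t) w).
    move=> t0 Xt oW Wx.
    have := @rp_right_continuous _ _ _ _ _ _ rightX t w x t0 Xt W.
    move=> /(_ (open_nbhs_nbhs (conj oW Wx))) /nbhs_ballP[e /= e0 He].
    have [N _ HN] := near_infty_natSinv_lt (PosNum e0).
    exists N => n Nn; apply: He; last exact: tn_gt.
    rewrite /ball/= ltr0_norm ?subr_lt0 ?tn_gt// opprB ltrBlDl.
    by apply: le_lt_trans (tn_le _ _) _ => //; rewrite ltrD2l; exact: HN.
  apply/seteqP; split => [p [x Ux Xx]|p [k _ [N _ SN]]].
    have [k _ Vx] := UV _ Ux.
    have [N HN] := ev _ _ _ _ (normr_ge0 p.1) (esym Xx) (oV k) Vx.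
    exists k => //; exists N => // n /= /HN [y Vy Xy]; exists y => //.
    exact: VF.
  (* The cemetery is absorbing: a path found in [F k] at a time after [|t|] was alive at [|t|]. *)
  rewrite /Y/=; case Xp : (X `|p.1| p.2) => [x|]; last first.
    have [y _] := SN N (leqnn N).
    rewrite (@rp_cemetery _ _ _ _ _ _ rightX `|p.1| (tn N `|p.1|))//.
    by rewrite normr_ge0/= ltW// tn_gt.
  exists x => //; apply: (FU k); apply: contrapT => Fx.
  have [M HM] := ev _ _ _ _ (normr_ge0 p.1) Xp (closed_openC (cF k)) Fx.
  have [y Fy Xy] := SN (maxn N M) (leq_maxl _ _).
  have [z Fz] := HM (maxn N M) (leq_maxr _ _).
  by rewrite -Xy => -[zy]; apply: Fz; rewrite zy.
suff : <<s @open E >> `<=` [set B | measurable (Y @^-1` (Some @` B))] by exact.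
apply: smallest_sub; last exact: oY.
split.
- by rewrite /= image_set0 preimage_set0; exact: measurable0.
- move=> A /= mA; rewrite (_ : _ @^-1` _ =
      Y @^-1` (Some @` [set: E]) `\` Y @^-1` (Some @` A)).
    by apply: measurableD => //; apply: oY; exact: openT.
  apply/seteqP; split => p; rewrite /preimage/=.
    move=> [x [_ nAx] <-]; split; first by exists x.
    by move=> [y Ay [yx]]; apply: nAx; rewrite -yx.
  by move=> [[x _ <-] nA]; exists x => //; split => // Ax; apply: nA; exists x.
- move=> A_ mA /=; rewrite image_bigcup preimage_bigcup.
  exact: bigcupT_measurable.
Qed.

End RightProcessMeasurability.

(** * Potential measures and the resolvent equation *)

Section Potential.
Context (R : realType) (E : ptopologicalType).
Hypothesis radonE : radon_metrizable R E.
Context (dO : measure_display) (Omega : measurableType dO).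
Variables (X : R -> Omega -> option E) (P : E -> probability Omega R).
Hypothesis rightX : right_process X P.
Notation mu := (@lebesgue_measure R).

Let pathfun (f : E -> \bar R) (p : measurableTypeR R * Omega) : \bar R :=
  oapp f 0 (X `|p.1| p.2).

Let measurable_pathfun (f : Borel E -> \bar R) : measurable_fun setT f ->
  measurable_fun setT (pathfun f).
Proof.
by apply: measurable_oapp => B; exact: (measurable_right_process radonE rightX).
Qed.

Let pathfun_ge0 f p : (forall x, 0 <= f x) -> 0 <= pathfun f p.
Proof. by move=> f0; rewrite /pathfun; case: X => /=. Qed.

Let discounted b (f : E -> \bar R) (p : measurableTypeR R * Omega) : \bar R :=
  (discount b p.1)%:E * pathfun f p.

Let measurable_discounted b (f : Borel E -> \bar R) : measurable_fun setT f ->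
  measurable_fun setT (discounted b f).
Proof.
move=> mf; apply: emeasurable_funM; last exact: measurable_pathfun.
exact: (measurableT_comp (measurable_EFin_discount b) measurable_fst).
Qed.

Let discounted_ge0 b f p : (forall x, 0 <= f x) -> 0 <= discounted b f p.
Proof. by move=> f0; rewrite mule_ge0 ?lee_fin ?discount_ge0// pathfun_ge0. Qed.

Let inner_resolventE b f w :
  \int[mu]_(t in `[0%R, +oo[) ((expR (- (b * t)))%:E * oapp f 0 (X t w)) =
  \int[mu]_t discounted b f (t, w).
Proof.
rewrite -integral_discountE; apply: eq_integral => t.
by rewrite inE/= in_itv/= andbT => t0; rewrite /pathfun/= ger0_norm.
Qed.

Lemma measurable_right_process_time (f : Borel E -> \bar R) t : (0 <= t)%R ->
  measurable_fun setT f -> measurable_fun setT (fun w => oapp f 0 (X t w)).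
Proof.
move=> t0; apply: measurable_oapp => B mB; exact: (rp_measurable rightX t0 mB).
Qed.

Lemma measurable_discounted_path b (f : Borel E -> \bar R) :
  measurable_fun setT f -> (forall x, 0 <= f x) ->
  measurable_fun setT (fun w =>
    \int[mu]_(t in `[0%R, +oo[) ((expR (- (b * t)))%:E * oapp f 0 (X t w))).
Proof.
move=> mf f0; under eq_fun do rewrite inner_resolventE.
apply: (measurable_fun_fubini_tonelli_G (m1 := mu) (discounted b f)).
  exact: measurable_discounted.
by move=> p; exact: discounted_ge0.
Qed.

Lemma resolvent_ge0 b f x : (forall y, 0 <= f y) -> 0 <= resolvent X P b f x.
Proof.
move=> f0; apply: integral_ge0 => w _; rewrite inner_resolventE.
by apply: integral_ge0 => t _; exact: discounted_ge0.
Qed.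

Let resolvent_prodE b (f : Borel E -> \bar R) x : measurable_fun setT f ->
  (forall y, 0 <= f y) ->
  resolvent X P b f x = \int[mu \x P x]_p discounted b f p.
Proof.
move=> mf f0.
have d0 p : 0 <= discounted b f p by exact: discounted_ge0.
rewrite (fubini_tonelli2 (discounted b f) (measurable_discounted b mf) d0).
by apply: eq_integral => w _; rewrite inner_resolventE.
Qed.

(** Stated for a general [M]: it serves for [P x], and for the mixture of the [P y] under a
    potential measure. *)
Lemma discounted_path_fubini (M : {sigma_finite_measure set Omega -> \bar R}) b
    (f : Borel E -> \bar R) : measurable_fun setT f -> (forall y, 0 <= f y) ->
  \int[M]_w \int[mu]_(t in `[0%R, +oo[) ((expR (- (b * t)))%:E * oapp f 0 (X t w)) =
  \int[mu]_t ((discount b t)%:E * \int[M]_w oapp f 0 (X `|t| w)).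
Proof.
move=> mf f0.
have d0 p : 0 <= discounted b f p by exact: discounted_ge0.
transitivity (\int[M]_w \int[mu]_t discounted b f (t, w)).
  by apply: eq_integral => w _; rewrite inner_resolventE.
rewrite -(fubini_tonelli (discounted b f) (measurable_discounted b mf) d0).
apply: eq_integral => t _.
rewrite -ge0_integralZl_EFin ?discount_ge0//.
- by move=> w _; exact: (pathfun_ge0 (t, w)).
- exact: measurable_right_process_time.
Qed.

Lemma resolvent_discount b (f : Borel E -> \bar R) x : measurable_fun setT f ->
  (forall y, 0 <= f y) -> resolvent X P b f x =
  \int[mu]_t ((discount b t)%:E * \int[P x]_w oapp f 0 (X `|t| w)).
Proof. exact: discounted_path_fubini. Qed.

Lemma measurable_semigroup_time (f : Borel E -> \bar R) x :
  measurable_fun setT f -> (forall y, 0 <= f y) ->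
  measurable_fun setT (fun t : measurableTypeR R => \int[P x]_w oapp f 0 (X `|t| w)).
Proof.
move=> mf f0.
apply: (measurable_fun_fubini_tonelli_F (m2 := P x) (pathfun f)).
  exact: measurable_pathfun.
by move=> p; exact: pathfun_ge0.
Qed.

Lemma resolvent_le_integral_discount b x (f : Borel E -> \bar R) :
  measurable_fun setT f -> (forall y, 0 <= f y) -> (forall y, f y <= 1) ->
  resolvent X P b f x <= \int[mu]_t (discount b t)%:E.
Proof.
move=> mf f0 f1; rewrite resolvent_discount//.
apply: ge0_le_integral => //.
- move=> t _; rewrite mule_ge0 ?lee_fin ?discount_ge0//.
  by apply: integral_ge0 => w _; exact: (pathfun_ge0 (t, w)).
- apply: emeasurable_funM; first exact: measurable_EFin_discount.
  exact: measurable_semigroup_time.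
- exact: measurable_EFin_discount.
- move=> t _; rewrite -[leRHS]mule1 lee_wpmul2l ?lee_fin ?discount_ge0//.
  apply: (@le_trans _ _ (\int[P x]_w cst 1 w)); last first.
    by rewrite integral_cst//= mul1e probability_setT.
  apply: ge0_le_integral => //.
  + by move=> w _; exact: (pathfun_ge0 (t, w)).
  + exact: measurable_right_process_time.
  + by move=> w _; case: (X `|t| w) => [y|] /=; rewrite ?lee01.
Qed.

Definition is_potential b x (V : {finite_measure set (Borel E) -> \bar R}) :=
  forall f : Borel E -> \bar R, measurable_fun setT f -> (forall y, 0 <= f y) ->
    resolvent X P b f x = \int[V]_y f y.

Lemma potential_measure b x : (0 < b)%R -> exists V, is_potential b x V.
Proof.
move=> b0; have [|||||V HV] := @Daniell_representation _ (Borel E) R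
  (fun f => \int[mu \x P x]_p discounted b f p); last first.
- by exists V => f mf f0; rewrite resolvent_prodE// HV.
- rewrite -resolvent_prodE//.
  apply: le_lt_trans (integral_discount_lty b0).
  by apply: resolvent_le_integral_discount => // y; rewrite lexx.
- move=> f_ mf_ f0 ndf; rewrite -monotone_convergence//.
  + apply: eq_integral => p _; rewrite /discounted limeMl//.
      congr (_ * _); rewrite /pathfun; case: X => //=.
      by apply/esym/cvg_lim => //; exact: cvg_cst.
    rewrite /pathfun; case: X => [y|] /=; last exact: is_cvg_cst.
    exact: ereal_nondecreasing_is_cvgn.
  + by move=> n; exact: measurable_discounted.
  + by move=> n p _; exact: discounted_ge0.
  + move=> p _ m n mn; rewrite lee_wpmul2l ?lee_fin ?discount_ge0//.
    by rewrite /pathfun; case: X => //= y; exact: ndf.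
- move=> c f c0 mf f0; rewrite -ge0_integralZl_EFin//.
  + apply: eq_integral => p _; rewrite /discounted muleCA; congr (_ * _).
    by rewrite /pathfun; case: X => //=; rewrite mule0.
  + by move=> p _; exact: discounted_ge0.
  + exact: measurable_discounted.
- move=> f g mf mg f0 g0; rewrite -ge0_integralD//; first last.
  + exact: measurable_discounted.
  + by move=> p _; exact: discounted_ge0.
  + exact: measurable_discounted.
  + by move=> p _; exact: discounted_ge0.
  apply: eq_integral => p _; rewrite /discounted -ge0_muleDr ?pathfun_ge0//.
  by congr (_ * _); rewrite /pathfun; case: X => //=; rewrite adde0.
- by move=> f f0; apply: integral_ge0 => p _; exact: discounted_ge0.
Qed.

(** If the potential of [N] vanishes, almost every path spends Lebesgue-null time in [N], so [f] and
    [g] agree along it at almost all times. *)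
Lemma resolvent_null_eq b x (N : set (Borel E)) (f g : E -> \bar R) :
  measurable N -> resolvent X P b (EFin \o \1_N) x = 0 ->
  (forall y, ~ N y -> f y = g y) -> resolvent X P b f x = resolvent X P b g x.
Proof.
move=> mN RN0 fg.
have mI : measurable_fun [set: Borel E] (EFin \o (\1_N : _ -> R)).
  by apply/measurable_EFinP; exact: measurable_indic.
have I0 y : 0 <= (EFin \o (\1_N : E -> R)) y by rewrite lee_fin.
have mJ := @measurable_discounted_path b _ mI I0.
have J0 w : 0 <= \int[mu]_(t in `[0%R, +oo[)
    ((expR (- (b * t)))%:E * oapp (EFin \o \1_N) 0 (X t w)).
  by rewrite inner_resolventE; apply: integral_ge0 => t _; exact: discounted_ge0.
apply: ae_eq_integral_nonmeasurable.
have /(ae_eq_integral_abs (P x) measurableT mJ) : \int[P x]_w `|\int[mu]_(t in `[0%R, +oo[)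
    ((expR (- (b * t)))%:E * oapp (EFin \o \1_N) 0 (X t w))| = 0.
  by rewrite -[RHS]RN0; apply: eq_integral => w _; rewrite gee0_abs.
apply: filterS => w /(_ Logic.I); rewrite inner_resolventE /= => Jw _.
rewrite !inner_resolventE; apply: ae_eq_integral_nonmeasurable.
have mw : measurable_fun setT (fun t : measurableTypeR R =>
    discounted b (EFin \o \1_N) (t, w)).
  exact: (measurableT_comp (measurable_discounted b mI) (measurable_pair2 w)).
have /(ae_eq_integral_abs mu measurableT mw) :
    \int[mu]_t `|discounted b (EFin \o \1_N) (t, w)| = 0.
  by rewrite -[RHS]Jw; apply: eq_integral => t _; rewrite gee0_abs// discounted_ge0.
apply: filterS => t /(_ Logic.I); rewrite /discounted /pathfun /= => + _.
case: X => [y|]//= /eqP; rewrite mule_eq0 => /orP[/eqP-> |]; first by rewrite !mul0e.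
rewrite eqe indicE pnatr_eq0 eqb0 => /negP yN; rewrite fg// => Ny.
by apply: yN; rewrite inE.
Qed.

Let measurable_indicE (N : set (Borel E)) : measurable N ->
  measurable_fun [set: Borel E] (EFin \o (\1_N : _ -> R)).
Proof. by move=> mN; apply/measurable_EFinP; exact: measurable_indic. Qed.

Lemma is_potential_indic b x V (N : set (Borel E)) : is_potential b x V ->
  measurable N -> resolvent X P b (EFin \o \1_N) x = V N.
Proof.
move=> Vx mN; rewrite Vx//; [|exact: measurable_indicE|].
  by rewrite integral_indic// setIT.
by move=> y; rewrite lee_fin.
Qed.

(** The Markov property moves [semigroup s f] at time [t] to [f] at time [t + s]. Passing to the
    Borel version [p] costs a [V]-null set [N]; since [V N] is the discounted integral over [t] of
    the probability of being in [N] at time [t], for almost every [t >= 0] the path is almost surely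
    outside [N]. *)
Lemma integral_potential_semigroup b x V (f : Borel E -> \bar R) s :
  is_potential b x V -> (0 <= s)%R -> measurable_fun setT f ->
  (forall y, 0 <= f y) -> \int[V]_y semigroup X P s f y =
  \int[mu]_t ((discount b t)%:E * \int[P x]_w oapp f 0 (X (`|t| + s)%R w)).
Proof.
move=> Vx s0 mf f0.
have mfs := measurable_right_process_time s0 mf.
have [|p [mp p0 [N [mN VN0 pN]]]] :=
    ae_measurable_kernel_integral (rp_kernel rightX) V mfs.
  by move=> w; case: X => /=.
have {}pN y : ~ N y -> semigroup X P s f y = p y.
  by move=> Ny; apply: contrapT => fp; apply/Ny/pN.
transitivity (\int[V]_y p y).
  apply: ae_eq_integral_nonmeasurable; exists N; split => // y /=.
  by move=> /not_implyP[_]; apply: contra_notP => /pN.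
rewrite -Vx// resolvent_discount//.
have mI := measurable_indicE mN.
have I0 y : 0 <= (EFin \o (\1_N : E -> R)) y by rewrite lee_fin.
apply: ae_eq_integral_nonmeasurable.
pose q t := (discount b t)%:E * \int[P x]_w oapp (EFin \o \1_N) 0 (X `|t| w).
have mq : measurable_fun setT (q : measurableTypeR R -> \bar R).
  apply: emeasurable_funM; first exact: measurable_EFin_discount.
  exact: measurable_semigroup_time.
have path0 t w : 0 <= oapp (EFin \o (\1_N : E -> R)) 0 (X `|t| w).
  by case: X => //= y; rewrite lee_fin.
have q0 t : 0 <= q t.
  by rewrite mule_ge0 ?lee_fin ?discount_ge0//; exact: integral_ge0.
have /(ae_eq_integral_abs mu measurableT mq) : \int[mu]_t `|q t| = 0.
  transitivity (resolvent X P b (EFin \o \1_N) x).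
    by rewrite resolvent_discount//; apply: eq_integral => t _; rewrite gee0_abs.
  by rewrite (is_potential_indic Vx mN); exact: VN0.
apply: filterS => t /(_ Logic.I)/eqP; rewrite mule_eq0 => /orP[/eqP-> _|/eqP qt0 _].
  by rewrite !mul0e.
congr (_ * _).
have -> : \int[P x]_w oapp f 0 (X (`|t| + s)%R w) =
    \int[P x]_w oapp (semigroup X P s f) 0 (X `|t| w).
  apply: (rp_markov rightX) => //.
  have [s1 s2 _] := smallest_sigma_algebra [set: Omega]
    [set A | exists (r : R) (B : set (Borel E)),
       [/\ (0 <= r <= `|t|)%R, measurable B & A = X r @^-1` (Some @` B)]].
  by have := s2 _ s1; rewrite setD0.
apply: ae_eq_integral_nonmeasurable.
have mIt := measurable_right_process_time (normr_ge0 t) mI.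
have /(ae_eq_integral_abs (P x) measurableT mIt) :
    \int[P x]_w `|oapp (EFin \o \1_N) 0 (X `|t| w)| = 0.
  by rewrite -[RHS]qt0; apply: eq_integral => w _; rewrite gee0_abs.
apply: filterS => w /(_ Logic.I) + _; case: X => [y|]//= /eqP.
rewrite eqe indicE pnatr_eq0 eqb0 => /negP yN; rewrite pN// => Ny.
by apply: yN; rewrite inE.
Qed.

(** Working under the mixture [M] replaces an exchange of [V] with the time integral of
    [semigroup s f], for which joint measurability in [s] and the starting point would be
    required. *)
Lemma integral_potential_resolvent a b x V (f : Borel E -> \bar R) :
  is_potential b x V -> measurable_fun setT f -> (forall y, 0 <= f y) ->
  \int[V]_y resolvent X P a f y =
  \int[mu]_(s in `[0%R, +oo[) ((expR (- (a * s)))%:E *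
    \int[mu]_(t in `[0%R, +oo[) ((expR (- (b * t)))%:E *
      \int[P x]_w oapp f 0 (X `|(t + s)%R| w))).
Proof.
move=> Vx mf f0.
have [M HM] := mixture_measure (rp_kernel rightX) V.
rewrite [LHS]HM; first last.
- move=> w; rewrite inner_resolventE; apply: integral_ge0 => t _.
  exact: discounted_ge0.
- exact: measurable_discounted_path.
rewrite (discounted_path_fubini M a mf f0) -integral_discountE.
apply: eq_integral => s; rewrite inE/= in_itv/= andbT => s0; congr (_ * _).
rewrite -HM; first last.
- by move=> w; case: X => /=.
- exact: measurable_right_process_time.
rewrite -[LHS]/(\int[V]_y semigroup X P `|s| f y).
rewrite (integral_potential_semigroup Vx)// -integral_discountE.
apply: eq_integral => t; rewrite inE/= in_itv/= andbT => t0; congr (_ * _).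
by rewrite !ger0_norm ?addr_ge0.
Qed.

Lemma resolvent_identity a b x V (f : Borel E -> \bar R) : (a < b)%R ->
  is_potential b x V -> measurable_fun setT f -> (forall y, 0 <= f y) ->
  resolvent X P a f x =
  resolvent X P b f x + (b - a)%:E * \int[V]_y resolvent X P a f y.
Proof.
move=> ab Vx mf f0; rewrite (integral_potential_resolvent a Vx mf f0).
rewrite !resolvent_discount// -!integral_discountE.
pose phi (t : R) := \int[P x]_w oapp f 0 (X `|t| w).
have phi0 t : 0 <= phi t by apply: integral_ge0 => w _; case: X => /=.
have mphi : measurable_fun setT phi by exact: measurable_semigroup_time.
(* The symmetry brings the transform of rate [b], the rate of [V], to the inside. *)
rewrite (laplace_resolvent mphi phi0 ab) (laplace_laplace_sym mphi phi0).
by [].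
Qed.

Lemma resolvent_identity_swap a b x V (f : Borel E -> \bar R) : (a < b)%R ->
  is_potential a x V -> measurable_fun setT f -> (forall y, 0 <= f y) ->
  resolvent X P a f x =
  resolvent X P b f x + (b - a)%:E * \int[V]_y resolvent X P b f y.
Proof.
move=> ab Vx mf f0; rewrite (integral_potential_resolvent b Vx mf f0).
rewrite !resolvent_discount// -!integral_discountE.
pose phi (t : R) := \int[P x]_w oapp f 0 (X `|t| w).
have phi0 t : 0 <= phi t by apply: integral_ge0 => w _; case: X => /=.
have mphi : measurable_fun setT phi by exact: measurable_semigroup_time.
exact: (laplace_resolvent mphi phi0 ab).
Qed.

End Potential.

(** * Compactness and subsequences *)

Section Subsequences.
Implicit Types phi psi rho : nat -> nat.

Lemma increasing_seq_geq phi : {homo phi : i j / (i < j)%N} ->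
  forall n, (n <= phi n)%N.
Proof.
move=> hphi; elim=> [//|n IH]; exact: leq_ltn_trans IH (hphi _ _ (ltnSn n)).
Qed.

Lemma increasing_seq_cvg phi : {homo phi : i j / (i < j)%N} ->
  phi n @[n --> \oo] --> \oo.
Proof.
move=> hphi A [N _ NA]; exists N => // n /= Nn; apply: NA => /=.
exact: leq_trans Nn (increasing_seq_geq hphi n).
Qed.

(* [Q k phi] says that the subsequence indexed by [phi] is good at level [k]. *)
Lemma diagonal_subsequence (Q : nat -> (nat -> nat) -> Prop) :
  (forall k phi, {homo phi : i j / (i < j)%N} ->
    exists2 psi, {homo psi : i j / (i < j)%N} & Q k (phi \o psi)) ->
  (forall k phi psi N rho, {homo rho : i j / (i < j)%N} -> Q k phi ->
    (forall n, (psi (n + N) = phi (rho n))%N) -> Q k psi) ->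
  exists2 phi, {homo phi : i j / (i < j)%N} & forall k, Q k phi.
Proof.
move=> Qsub Qtail.
pose incr phi := {homo phi : i j / (i < j)%N}.
have /choice[next nextP] (kp : nat * {phi | incr phi}) :
    exists psi : {psi | incr psi}, Q kp.1 (sval kp.2 \o sval psi).
  by have [psi ipsi Qpsi] := Qsub kp.1 _ (svalP kp.2); exists (exist _ psi ipsi).
have icomp phi psi : incr phi -> incr psi -> incr (phi \o psi).
  by move=> iphi ipsi i j ij; apply/iphi/ipsi.
pose comp (f g : {phi | incr phi}) : {phi | incr phi} :=
  exist _ (sval f \o sval g) (icomp _ _ (svalP f) (svalP g)).
have iid : incr id by [].
pose Phi := fix Phi k := if k is k'.+1 then comp (Phi k') (next (k', Phi k'))
  else exist _ id iid.
have QPhi k : Q k (sval (Phi k.+1)) by exact: nextP (k, Phi k).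
have PhiD k n : exists2 rho, incr rho & sval (Phi (k + n)%N) = sval (Phi k) \o rho.
  elim: n => [|n [rho irho IH]]; first by exists id => //; rewrite addn0.
  exists (rho \o sval (next ((k + n)%N, Phi (k + n)%N))).
    exact: (icomp _ _ irho (svalP _)).
  by rewrite addnS /= IH.
pose phi n := sval (Phi n) n.
have phiS n : (phi n < phi n.+1)%N.
  rewrite /phi /= ; apply: (svalP (Phi n)).
  exact: increasing_seq_geq (svalP (next (n, Phi n))) n.+1.
have iphi : incr phi by apply: homo_ltn => //; exact: ltn_trans.
exists phi => // k.
have /choice[rho /all_and2[irho rhoE]] n : exists rho,
    incr rho /\ sval (Phi (k.+1 + n)%N) = sval (Phi k.+1) \o rho.
  by have [rho ? ?] := PhiD k.+1 n; exists rho.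
(* [Q k] is secured by [Phi k.+1], of which the diagonal is a subsequence from index [k.+1] on. *)
apply: (Qtail k _ _ k.+1 (fun n => rho n (k.+1 + n)%N) _ (QPhi k)); last first.
  by move=> n; rewrite /phi addnC rhoE.
(* [Phi k.+1] reflects the order, so the index map inherits strict monotonicity from the
   diagonal. *)
have iPhi i j : (sval (Phi k.+1) i < sval (Phi k.+1) j)%N -> (i < j)%N.
  apply: contraTT; rewrite -!leqNgt leq_eqVlt => /orP[/eqP->//|ji].
  exact/ltnW/(svalP (Phi k.+1)).
move=> i j ij; apply: iPhi.
have := iphi (k.+1 + i)%N (k.+1 + j)%N.
by rewrite /phi !rhoE /=; apply; rewrite ltn_add2l.
Qed.

End Subsequences.

(** * Precompact sets and convergent subsequences *)

Section SequentialCompactness.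
Context (R : realType) (M : metricType R).
Implicit Types (A : set M) (w : nat -> M).

(** The rate [r] can be chosen summable, which upgrades L^1 convergence to convergence almost
    everywhere. *)
Lemma precompact_cvg_subsequence A w (r : nat -> R) :
  (forall n, 0 < r n)%R -> precompact A -> (forall n, A (w n)) ->
  exists (phi : nat -> nat) (z : M), {homo phi : i j / (i < j)%N} /\
    forall n, (mdist z (w (phi n)) < r n)%R.
Proof.
move=> r0 [B AB [cB _]] Aw.
have [|z [_ wz]] := cB (w @ \oo) _.
  by exists 0%N => // n _; exact/AB/Aw.
have near_z n N : exists m, (N < m)%N /\ (mdist z (w m) < r n)%R.
  have [||_ [[m /= Nm <-] zm]] := wz (w @` [set m | (N < m)%N]) (ball z (r n)%R).
  - by exists N.+1 => // m /= Nm; exists m.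
  - exact: nbhsx_ballx.
  by exists m; split => //; move: zm; rewrite ballEmdist.
have /choice[f fP] (nN : nat * nat) := near_z nN.1 nN.2.
pose phi := fix phi n := if n is n'.+1 then f (n, phi n') else f (0%N, 0%N).
exists phi, z; split; last first.
  by case=> [|n]; [exact: (fP (0%N, 0%N)).2|exact: (fP (n.+1, phi n)).2].
by apply: homo_ltn => [? ? ?|n]; [exact: ltn_trans|exact: (fP (n.+1, phi n)).1].
Qed.

(** Without a finite cover by [e]-balls there is an [e]-separated sequence in [A], which has no
    convergent subsequence. Total boundedness gives an ultrafilter arbitrarily small balls; points
    of [A] near their centers have a subsequence with a limit, to which the ultrafilter converges.
    The hypothesis thus also supplies the limit that completeness would give. *)
Lemma cvg_subsequence_precompact A :
  (forall w, (forall n, A (w n)) -> exists (phi : nat -> nat) (z : M),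
     {homo phi : i j / (i < j)%N} /\ w (phi n) @[n --> \oo] --> z) ->
  precompact A.
Proof.
move=> Asub.
have cover e : (0 < e)%R -> exists s : seq M, A `<=` \bigcup_(z in [set` s]) ball z e.
  move=> e0; apply: contrapT => /forallNP ncov.
  have /choice[f fP] (s : seq M) : exists y, A y /\ forall z, z \in s -> ~ ball z e y.
    have /existsNP[y /not_implyP[Ay ny]] := ncov s.
    by exists y; split => // z zs bzy; apply: ny; exists z.
  pose S := fix S n := if n is n'.+1 then f (S n') :: S n' else [::].
  pose w n := f (S n).
  have wS n k : w n \in S (n + k.+1)%N.
    by elim: k => [|k IH]; rewrite addnS /= ?addn0 in_cons ?eqxx// IH orbT.
  have wsep m n : (m < n)%N -> ~ ball (w m) e (w n).
    move=> mn; apply: (fP (S n)).2.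
    by rewrite -(subnKC mn) addSnnS.
  have [phi [z [iphi wz]]] := Asub w (fun n => (fP (S n)).1).
  have [N _ HN] := wz _ (nbhsx_ballx z _ (divr_gt0 e0 (ltr0Sn _ 1))).
  apply: (wsep (phi N) (phi N.+1)); first exact: iphi.
  rewrite [e]splitr; apply: (@ball_triangle _ _ z).
    exact/ball_sym/HN/leqnn.
  exact/HN/leqnSn.
rewrite precompactE compact_ultra => F UF FA.
pose r n : R := n.+1%:R^-1%R.
have r0 n : (0 < r n)%R by rewrite /r invr_gt0 ltr0Sn.
have /choice[c cP] n : exists c, F (ball c (r n + r n)%R).
  have [s As] := cover _ (r0 n).
  (* The radius doubles because [F] lives on the closure of [A], while the balls cover [A]
     itself. *)
  have : F (\bigcup_(z in [set` s]) ball z (r n + r n)%R).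
    apply: filterS FA => x /(_ _ (nbhsx_ballx x _ (r0 n)))[y [Ay xy]].
    have [z zs zy] := As _ Ay; exists z => //.
    by apply: ball_triangle zy _; exact: ball_sym.
  rewrite bigcup_seq; elim: s {As} => [|z s IH].
    by rewrite big_nil => /filter_ex[].
  rewrite big_cons => FU.
  have [Fz|Fnz] := in_ultra_setVsetC (ball z (r n + r n)%R) UF.
    by exists z.
  apply: IH; apply: filterS (filterI FU Fnz) => x [[//|] //].
have /choice[a aP] n : exists a, A a /\
    forall i, (i <= n)%N -> ball (c i) (r i + r i + r n)%R a.
  have Fn : F [set x | forall i, (i <= n)%N -> ball (c i) (r i + r i)%R x].
    elim: n => [|n IH].
      by apply: filterS (cP 0%N) => x c0x i; rewrite leqn0 => /eqP ->.
    apply: filterS (filterI IH (cP n.+1)) => x [xn xn1] i.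
    by rewrite leq_eqVlt ltnS => /orP[/eqP ->|/xn].
  have FI : F (closure A `&` [set x | forall i, (i <= n)%N -> ball (c i) (r i + r i)%R x]).
    exact: filterI.
  move: FI.
  move=> /filter_ex[x [Ax xB]].
  have [a [Aa xa]] := Ax _ (nbhsx_ballx x _ (r0 n)).
  by exists a; split => // i ni; apply: ball_triangle xa; exact: xB.
have [phi [z [iphi az]]] := Asub a (fun n => (aP n).1).
have Fz : F --> z.
  move=> B /nbhs_ballP[e /= e0 eB].
  (* From [z] to [a] costs [e / 10], from [a] to the center [3 r], from the center to [x] another
     [2 r], with [r < e / 10]. *)
  have e10 : (0 < e / 10)%R by rewrite divr_gt0.
  have [N1 _ HN1] := az _ (nbhsx_ballx z _ e10).
  have [N2 _ HN2] := near_infty_natSinv_lt (PosNum e10).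
  pose n := maxn N1 N2.
  have rn : (r (phi n) < e / 10)%R.
    by apply: HN2 => /=; rewrite (leq_trans (leq_maxr N1 N2))// increasing_seq_geq.
  apply: filterS (cP (phi n)) => x cx; apply: eB.
  have zc := ball_triangle (HN1 n (leq_maxl _ _)) (ball_sym ((aP (phi n)).2 _ (leqnn _))).
  apply: le_ball (ball_triangle zc cx); move: rn; set q := r _; lra.
exists z; split => //.
have /closure_id -> := @closed_closure _ A.
move=> B zB; have FB : F (closure A `&` B) by apply: filterI => //; exact: Fz.
exact: filter_ex FB.
Qed.

End SequentialCompactness.

(** * Convergence through uniform approximation *)

Section TruncationConvergence.
Context (R : realType).

Lemma cvg_ereal_eventually_lt (u : nat -> \bar R) (l c : \bar R) :
  u n @[n --> \oo] --> l -> l < c -> exists N, forall n, (N <= n)%N -> u n < c.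
Proof. by move=> ul lc; have [N _ HN] := ul _ (open_ereal_lt' lc); exists N. Qed.

Lemma cvg_ereal_eventually_gt (u : nat -> \bar R) (l c : \bar R) :
  u n @[n --> \oo] --> l -> c < l -> exists N, forall n, (N <= n)%N -> c < u n.
Proof. by move=> ul lc; have [N _ HN] := ul _ (open_ereal_gt' lc); exists N. Qed.

(** The errors [H k] are uniform in [n], so [f] is Cauchy. Its values may be infinite, hence
    finiteness from some index on comes before the passage to the reals. *)
Lemma cvg_squeeze_approximation (f : nat -> \bar R) (g : nat -> nat -> \bar R)
    (H : nat -> \bar R) :
  (forall k n, 0 <= g k n) -> (forall k n, g k n <= f n) ->
  (forall k n, f n <= g k n + H k) -> H k @[k --> \oo] --> 0 ->
  (forall k, exists l : R, g k n @[n --> \oo] --> l%:E) ->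
  exists l : R, f n @[n --> \oo] --> l%:E.
Proof.
move=> g0 gf fgH H0 gl.
have f0 n : 0 <= f n by exact: le_trans (g0 0%N n) (gf _ _).
have Hlt e : (0 < e)%R -> exists k, H k < e%:E.
  move=> e0; have [|K HK] := cvg_ereal_eventually_lt H0 (_ : 0 < e%:E).
    by rewrite lte_fin.
  by exists K; exact: HK (leqnn _).
have gcauchy k e : (0 < e)%R -> exists N, forall n m, (N <= n)%N -> (N <= m)%N ->
    g k n <= g k m + e%:E.
  move=> e0; have [l gkl] := gl k.
  have e20 : (0 < e / 2)%R by rewrite divr_gt0.
  have [|N1 HN1] := cvg_ereal_eventually_lt gkl (_ : _ < (l + e / 2)%:E); first by rewrite lte_fin ltrDl.
  have [|N2 HN2] := cvg_ereal_eventually_gt gkl (_ : (l - e / 2)%:E < _); first by rewrite lte_fin gtrDl oppr_lt0.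
  exists (maxn N1 N2) => n m; rewrite !geq_max => /andP[n1 n2] /andP[m1 m2].
  apply: le_trans (ltW (HN1 n n1)) _.
  apply: le_trans (leeD (ltW (HN2 m m2)) (lexx _)).
  by rewrite -EFinD lee_fin; lra.
have ffin : exists N, forall n, (N <= n)%N -> f n \is a fin_num.
  have [k Hk] := Hlt 1%R ltr01.
  have [l gkl] := gl k.
  have [|N1 HN1] := cvg_ereal_eventually_lt gkl (_ : _ < (l + 1)%:E); first by rewrite lte_fin ltrDl.
  exists N1 => n N1n; rewrite ge0_fin_numE//.
  apply: le_lt_trans (fgH k n) _; rewrite lte_add_pinfty//.
    by apply: lt_trans (HN1 n N1n) _; rewrite ltry.
  by apply: lt_trans Hk _; rewrite ltry.
have [N HN] := ffin.
have fcauchy e : (0 < e)%R -> exists M, forall n m, (M <= n)%N -> (M <= m)%N ->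
    f n <= f m + e%:E.
  move=> e0; have e20 : (0 < e / 2)%R by rewrite divr_gt0.
  have [k Hk] := Hlt _ e20; have [M HM] := gcauchy k _ e20.
  exists M => n m Mn Mm; apply: le_trans (fgH k n) _.
  rewrite [e]splitr EFinD addeA; apply: leeD (ltW Hk).
  apply: le_trans (HM n m Mn Mm) _; exact: leeD.
have : cauchy_ex (fine (f n) @[n --> \oo]).
  move=> e /= e0; have [M HM] := fcauchy _ (divr_gt0 e0 (ltr0Sn _ 1)).
  pose K := maxn N M; exists (fine (f K)); exists K => // n /=; rewrite geq_max => /andP[Nn Mn].
  have NK : (N <= K)%N by exact: leq_maxl.
  have MK : (M <= K)%N by exact: leq_maxr.
  have := HM n K Mn MK; have := HM K n MK Mn.
  rewrite -(fineK (HN _ Nn)) -(fineK (HN _ NK)) -!EFinD !lee_fin => h1 h2.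
  rewrite /ball/= ltr_norml; apply/andP; split; lra.
move=> /cauchy_exP/cauchy_cvgP; move=> /cvg_ex[l fl].
exists l; apply/fine_cvgP; split => //.
by exists N => // n /= /HN.
Qed.

Lemma cvg_subsequence_tail (c : nat -> \bar R) (l : \bar R) (phi psi rho : nat -> nat) N :
  {homo rho : i j / (i < j)%N} -> (forall n, psi (n + N) = phi (rho n))%N ->
  c (phi n) @[n --> \oo] --> l -> c (psi n) @[n --> \oo] --> l.
Proof.
move=> irho psiE cl; rewrite -(cvg_shiftn N) /=.
under eq_fun do rewrite psiE.
exact: (cvg_comp _ _ (increasing_seq_cvg irho) cl).
Qed.

End TruncationConvergence.

(** * Convergence in L^1 and almost everywhere *)

Section L1Classes.
Context d (T : measurableType d) (R : realType).
Variable m : {measure set T -> \bar R}.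

Lemma exists_L1 (f : T -> R) : m.-integrable setT (EFin \o f) ->
  exists u : L1 m, \forall x \ae m, L1val u x = f x.
Proof.
move=> /integrableP[/measurable_EFinP mf fi].
pose F : {mfun T >-> measurableTypeR R} := HB.pack f (isMeasurableFun.Build _ _ T (measurableTypeR R) f mf).
pose c : {mfun_ m, T >-> measurableTypeR R} := \pi_(_)%qT F.
have cF : \forall x \ae m, (c : T -> R) x = f x.
  have : (repr c = F %[mod {mfun_ m, T >-> measurableTypeR R}])%qT by rewrite reprK.
  by move=> /eqmodP/asboolP; apply: filterS => x; exact.
have cn : finite_norm m 1 (c : T -> R).
  rewrite /finite_norm Lnorm1.
  rewrite (@ae_eq_integral_nonmeasurable _ _ _ _ _ _ (fun x => `|(f x)%:E|))//.
  by apply: filterS cF => x cfx _; rewrite /= cfx.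
pose u : LspaceType m (@lexx _ _ 1) :=
  LebesgueSpace.Pack (LebesgueSpace.Class (isFinLebesgue.Build _ _ _ m 1 (@lexx _ _ 1) c cn)).
by exists u; exact: cF.
Qed.

Lemma exists_L1_ereal (f : T -> \bar R) : m.-integrable setT f ->
  exists u : L1 m, \forall x \ae m, (L1val u x)%:E = f x.
Proof.
move=> fi; have [|u uf] := @exists_L1 (fine \o f).
  apply: (le_integrable measurableT _ _ fi).
    apply/measurable_EFinP; apply: measurableT_comp => //.
    by have /integrableP[] := fi.
  by move=> x _ /=; case: (f x) => [r| |]//=; rewrite normr0 leey.
exists u; have := integrable_ae measurableT fi.
by apply: filterS2 uf => x -> /(_ Logic.I)/fineK.
Qed.

(** Summability makes the series of the [|z - w n|] integrable, hence finite almost everywhere, and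
    there its terms tend to 0. *)
Lemma L1_summable_cvg_ae (w : nat -> L1 m) (z : L1 m) :
  \sum_(n <oo) (L1dist z (w n))%:E < +oo ->
  \forall x \ae m, L1val (w n) x @[n --> \oo] --> L1val z x.
Proof.
move=> wz.
pose D n x := `|(L1val z x - L1val (w n) x)%:E|.
have mD n : measurable_fun setT (D n).
  apply: measurableT_comp => //.
  by have /integrableP[] := L1dist_integrable z (w n).
have D0 n x : 0 <= D n x by exact: abse_ge0.
have mS : measurable_fun setT (fun x => \sum_(n <oo) D n x).
  exact: ge0_emeasurable_sum.
have Si : m.-integrable setT (fun x => \sum_(n <oo) D n x).
  apply/integrableP; split => //.
  under eq_integral do rewrite gee0_abs ?nneseries_ge0//.
  rewrite integral_nneseries//.
  by under eq_eseriesr do rewrite -L1distE.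
have := integrable_ae measurableT Si; apply: filterS => x /(_ Logic.I) Sfin.
have tail0 : \sum_(N <= n <oo) D n x @[N --> \oo] --> 0.
  apply: nneseries_tail_cvg => //; rewrite ltey_eq Sfin//.
have D_0 : D n x @[n --> \oo] --> 0.
  apply: (squeeze_cvge _ (cvg_cst 0) tail0); apply: nearW => n.
  rewrite D0/= (nneseries_split n 1)//= addn1 big_nat1 leeDl// nneseries_ge0//.
apply/cvgrPdist_lt => e e0.
have [|N HN] := cvg_ereal_eventually_lt D_0 (_ : _ < e%:E); first by rewrite lte_fin.
by exists N => // n /= /HN; rewrite /D lte_fin.
Qed.

Lemma L1_dominated_cvg (w : nat -> L1 m) (G : T -> \bar R) :
  m.-integrable setT G ->
  (forall n, \forall x \ae m, `|(L1val (w n) x)%:E| <= G x) ->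
  (\forall x \ae m, exists l : R, L1val (w n) x @[n --> \oo] --> l) ->
  exists z : L1 m, w n @[n --> \oo] --> z.
Proof.
move=> iG wG wl.
pose f n x := (L1val (w n) x)%:E.
have mf n : measurable_fun setT (f n) by have /integrableP[] := L1val_integrable (w n).
pose L x := limn_esup (f ^~ x).
have mL : measurable_fun setT L by exact: measurable_fun_limn_esup.
have fL : {ae m, forall x, setT x -> f n x @[n --> \oo] --> L x}.
  apply: filterS wl => x [l wl] _.
  have fl : f n x @[n --> \oo] --> l%:E.
    by apply: cvg_EFin; [exact: nearW|exact: wl].
  by rewrite /L is_cvg_limn_esupE; [rewrite (cvg_lim _ fl)|apply/cvg_ex; exists l%:E].
have fG : {ae m, forall x n, setT x -> `|f n x| <= G x}.
  by apply: filterS (ae_foralln wG) => x wGx n _; exact: wGx.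
have [iL f_L _] := dominated_convergence measurableT mf mL fL iG fG.
have [z zL] := exists_L1_ereal iL.
exists z; apply/cvg_ballP => e e0.
have [|N HN] := cvg_ereal_eventually_lt f_L (_ : _ < e%:E); first by rewrite lte_fin.
exists N => // n /= /HN; rewrite ballEmdist => fLe; rewrite /= -lte_fin.
apply: le_lt_trans fLe; rewrite -[mdist z (w n)]/(L1dist z (w n)) L1distE.
rewrite le_eqVlt; apply/orP; left; apply/eqP.
apply: ae_eq_integral_nonmeasurable.
by apply: filterS zL => x zLx _; rewrite /f EFinB zLx -abseN fin_num_oppeB// addeC.
Qed.

Lemma integral_dominated_cvg0 (H : nat -> T -> \bar R) (G : T -> \bar R) :
  (forall k, measurable_fun setT (H k)) -> measurable_fun setT G ->
  (forall k x, 0 <= H k x) -> (forall k x, H k x <= G x) ->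
  \int[m]_x G x < +oo -> (forall x, H k x @[k --> \oo] --> 0) ->
  \int[m]_x H k x @[k --> \oo] --> 0.
Proof.
move=> mH mG H0 HG iG H_0.
have G0 x : 0 <= G x by exact: le_trans (H0 0%N x) (HG 0%N x).
have iG' : m.-integrable setT G.
  apply/integrableP; split => //.
  by under eq_integral do rewrite gee0_abs//.
have H_0' : {ae m, forall x, setT x -> H n x @[n --> \oo] --> cst 0 x}.
  by apply: aeW => x _; exact: H_0.
have HG' : {ae m, forall x n, setT x -> `|H n x| <= G x}.
  by apply: aeW => x n _; rewrite gee0_abs.
have [_ _] := dominated_convergence measurableT mH (measurable_cst _) H_0' iG' HG'.
by rewrite integral0.
Qed.

Lemma ae_measurable_bounded_cvg (V : {finite_measure set T -> \bar R})
    (h : nat -> T -> \bar R) (c : R) :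
  (forall n, ae_measurable V (h n)) ->
  (forall n x, 0 <= h n x) -> (forall n x, h n x <= c%:E) ->
  (\forall x \ae V, exists l : R, h n x @[n --> \oo] --> l%:E) ->
  exists J : R, \int[V]_x h n x @[n --> \oo] --> J%:E.
Proof.
move=> /choice[g /all_and3[mg g0 hg]] h0 hc hl.
pose L x := limn_esup (g ^~ x).
have mL : measurable_fun setT L by exact: measurable_fun_limn_esup.
have gh := ae_foralln hg.
have gL : {ae V, forall x, setT x -> g n x @[n --> \oo] --> L x}.
  apply: filterS2 gh hl => x ghx [l hxl] _.
  have gl : g n x @[n --> \oo] --> l%:E by under eq_fun do rewrite -ghx.
  by rewrite /L is_cvg_limn_esupE; [rewrite (cvg_lim _ gl)|apply/cvg_ex; exists l%:E].
have gc : {ae V, forall x n, setT x -> `|g n x| <= cst c%:E x}.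
  by apply: filterS gh => x ghx n _; rewrite -ghx gee0_abs.
have ic : V.-integrable setT (cst c%:E).
  exact: finite_measure_integrable_cst.
have [iL _ cvgL] := dominated_convergence measurableT mg mL gL ic gc.
exists (fine (\int[V]_x L x)); rewrite fineK; last exact: integrable_fin_num.
rewrite (_ : (fun n => \int[V]_x h n x) = (fun n => \int[V]_x g n x))//.
apply/funext => n; apply: ae_eq_integral_nonmeasurable.
by apply: filterS (hg n) => x ->.
Qed.

End L1Classes.

(** * Excessive measures and the compactness property *)

Section ExcessiveMeasure.
Context (R : realType) (E : ptopologicalType).
Hypothesis radonE : radon_metrizable R E.
Context (dO : measure_display) (Omega : measurableType dO).
Variables (X : R -> Omega -> option E) (P : E -> probability Omega R).
Hypothesis rightX : right_process X P.
Variable m : {sigma_finite_measure set (Borel E) -> \bar R}.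
Hypothesis excm : excessive_measure X P m.

Let ae_m_filter : Filter (almost_everywhere m) := ae_filter_ringOfSetsType m.
#[local] Existing Instance ae_m_filter.

Lemma ae_measurable_resolvent (mu : {sigma_finite_measure set (Borel E) -> \bar R})
    a (f : Borel E -> \bar R) : measurable_fun setT f -> (forall y, 0 <= f y) ->
  ae_measurable mu (resolvent X P a f).
Proof.
move=> mf f0; apply: (ae_measurable_kernel_integral (rp_kernel rightX)).
  exact: (measurable_discounted_path radonE rightX).
move=> w; apply: integral_ge0 => t _; rewrite mule_ge0 ?lee_fin ?expR_ge0//.
by case: X => /=.
Qed.

Lemma integrable_resolvent a (f : Borel E -> \bar R) : (0 < a)%R ->
  measurable_fun setT f -> (forall y, 0 <= f y) -> \int[m]_y f y < +oo ->
  exists g : Borel E -> \bar R, [/\ m.-integrable setT g, forall y, 0 <= g y,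
    a%:E * \int[m]_y g y <= \int[m]_y f y &
    \forall y \ae m, resolvent X P a f y = g y].
Proof.
move=> a0 mf f0 foo; have [g [mg g0 Rg]] := ae_measurable_resolvent m a mf f0.
have gf : a%:E * \int[m]_y g y <= \int[m]_y f y.
  apply: le_trans (excm a0 (conj mf f0)).
  rewrite -ge0_integralZl_EFin//; last exact: ltW.
  rewrite le_eqVlt; apply/orP; left; apply/eqP.
  by apply: ae_eq_integral_nonmeasurable; apply: filterS Rg => x ->.
exists g; split => //; apply/integrableP; split => //.
under eq_integral do rewrite gee0_abs//.
rewrite ltNge leye_eq; apply/negP => /eqP goo.
by move: (le_lt_trans gf foo); rewrite goo gt0_muley// ?lte_fin// ltxx.
Qed.

(** Excessiveness for the indicator of [N] bounds [a] times the integral of its resolvent by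
    [m N = 0]. *)
Lemma excessive_null a (N : set (Borel E)) : (0 < a)%R -> measurable N ->
  m N = 0 -> \forall x \ae m, resolvent X P a (EFin \o \1_N) x = 0.
Proof.
move=> a0 mN mN0.
have mI : measurable_fun [set: Borel E] (EFin \o (\1_N : _ -> R)).
  by apply/measurable_EFinP; exact: measurable_indic.
have I0 y : 0 <= (EFin \o (\1_N : E -> R)) y by rewrite lee_fin.
have IN0 : \int[m]_y (EFin \o \1_N) y = 0 by rewrite integral_indic// setIT.
have [|g [ig g0 gle Rg]] := integrable_resolvent a0 mI I0; first by rewrite IN0.
have /integrableP[mg _] := ig.
have : \int[m]_y `|g y| = 0.
  under eq_integral do rewrite gee0_abs//.
  apply/eqP; rewrite eq_le integral_ge0// andbT.
  by move: gle; rewrite IN0 pmule_rle0// lte_fin.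
move=> /(ae_eq_integral_abs m measurableT mg) g_0.
have {}g_0 : \forall y \ae m, g y = 0 by apply: filterS g_0 => y /(_ Logic.I).
by apply: filterS2 Rg g_0 => x ->.

Qed.

Lemma excessive_resolvent_ae_eq a (f g : E -> \bar R) : (0 < a)%R ->
  (\forall x \ae m, f x = g x) ->
  \forall x \ae m, resolvent X P a f x = resolvent X P a g x.
Proof.
move=> a0 [N [mN mN0 fgN]]; apply: filterS (excessive_null a0 mN mN0) => x RN.
apply: (resolvent_null_eq radonE rightX mN RN) => y Ny.
by apply: contrapT => fg; apply/Ny/fgN.
Qed.

Lemma excessive_potential_ae a (Q : E -> Prop) : (0 < a)%R ->
  (\forall y \ae m, Q y) ->
  \forall x \ae m, forall V, is_potential X P a x V -> \forall y \ae V, Q y.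
Proof.
move=> a0 [N [mN mN0 QN]]; apply: filterS (excessive_null a0 mN mN0) => x RN V Vx.
exists N; split => //; rewrite -RN; exact/esym/(is_potential_indic Vx mN).
Qed.

Lemma resolvent_B1_bounded a : (0 < a)%R -> exists c : R,
  forall u x, B1 R E u -> resolvent X P a u x <= c%:E.
Proof.
move=> a0; exists (fine (\int[lebesgue_measure]_t (discount a t)%:E)) => u x [[mu u0] u1].
rewrite fineK; last first.
  rewrite ge0_fin_numE; first exact: integral_discount_lty.
  by apply: integral_ge0 => t _; rewrite lee_fin discount_ge0.
exact: (resolvent_le_integral_discount radonE rightX).
Qed.

Lemma resolvent_cvg_change a b (u : nat -> E -> \bar R) : (0 < a)%R -> (0 < b)%R ->
  (forall n, B1 R E (u n)) ->
  (\forall x \ae m, exists l : R, resolvent X P a (u n) x @[n --> \oo] --> l%:E) ->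
  \forall x \ae m, exists l : R, resolvent X P b (u n) x @[n --> \oo] --> l%:E.
Proof.
move=> a0 b0 B1u Ra.
have mu n : measurable_fun [set: Borel E] (u n) by have [[]] := B1u n.
have u0 n x : 0 <= u n x by have [[_ +] _] := B1u n; exact.
have [c Rc] := resolvent_B1_bounded a0.
apply: filterS2 Ra (excessive_potential_ae b0 Ra) => x [l Rl] VRa.
have [V Vx] := potential_measure radonE rightX x b0.
have [J cJ] : exists J : R,
    \int[V]_y resolvent X P a (u n) y @[n --> \oo] --> J%:E.
  apply: (@ae_measurable_bounded_cvg _ _ _ V _ c) => //.
  - by move=> n; exact: ae_measurable_resolvent.
  - by move=> n y; exact: resolvent_ge0.
  - by move=> n y; exact: Rc.
  - exact: VRa.
(* For [a < b] the equation is solved for the resolvent at [b], the subtraction being legitimate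
   since the terms are finite; for [b < a] it expresses that resolvent directly. *)
have [ab|ba|<-] := ltgtP a b; last by exists l.
- exists (l - (b - a) * J)%R.
  have RE n : resolvent X P a (u n) x - (b - a)%:E * \int[V]_y resolvent X P a (u n) y
      = resolvent X P b (u n) x.
    have RaE := resolvent_identity radonE rightX ab Vx (mu n) (u0 n).
    rewrite [X in X - _]RaE addeK// ge0_fin_numE.
      apply: le_lt_trans (ltry c); apply: le_trans (Rc _ x (B1u n)).
      by rewrite RaE leeDr// resolvent_ge0.
    rewrite mule_ge0 ?lee_fin ?subr_ge0 ?(ltW ab)//.
    by apply: integral_ge0 => y _; exact: resolvent_ge0.
  under eq_fun do rewrite -RE.
  rewrite EFinB EFinM; apply: cvgeB => //.
  by apply: cvgeZl.
- exists (l + (a - b) * J)%R.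
  under eq_fun do rewrite (resolvent_identity_swap radonE rightX ba Vx (mu _) (u0 _)).
  rewrite EFinD EFinM; apply: cvgeD => //.
  by apply: cvgeZl.
Qed.

Lemma compactness_property_subsequence a (u : nat -> E -> \bar R) : (0 < a)%R ->
  compactness_property X P (B1 R E) m -> (forall n, B1 R E (u n)) ->
  exists2 phi : nat -> nat, {homo phi : i j / (i < j)%N} &
    \forall x \ae m, exists l : R,
      resolvent X P a (u (phi n)) x @[n --> \oo] --> l%:E.
Proof.
move=> a0 cpt B1u; have [Lambda [phi [L0 supL iphi RL]]] := cpt u B1u.
(* The supremum of the empty set is not [+oo], and a single rate suffices. *)
have [b Lb] : exists b, Lambda b.
  apply: contrapT => /forallNP nL; move: supL.
  by rewrite (_ : Lambda = set0) ?image_set0 ?ereal_sup0// -subset0 => b /nL.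
exists phi => //; apply: (resolvent_cvg_change (L0 _ Lb) a0) => //.
exact: RL.
Qed.

Lemma resolventZ a (c : R) x (f : Borel E -> \bar R) : (0 < a)%R -> (0 <= c)%R ->
  measurable_fun setT f -> (forall y, 0 <= f y) ->
  resolvent X P a (fun y => c%:E * f y) x = c%:E * resolvent X P a f x.
Proof.
move=> a0 c0 mf f0; have [V Vx] := potential_measure radonE rightX x a0.
rewrite !Vx//; last 2 first.
- exact: measurable_funeM.
- by move=> y; rewrite mule_ge0.
exact: ge0_integralZl_EFin.
Qed.

Lemma le_resolvent a x (f g : Borel E -> \bar R) : (0 < a)%R ->
  measurable_fun setT f -> measurable_fun setT g -> (forall y, 0 <= f y) ->
  (forall y, f y <= g y) -> resolvent X P a f x <= resolvent X P a g x.
Proof.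
move=> a0 mf mg f0 fg; have [V Vx] := potential_measure radonE rightX x a0.
have g0 y : 0 <= g y by exact: le_trans (f0 y) (fg y).
by rewrite !Vx//; exact: ge0_le_integral.
Qed.

(* The sequences in [order_interval v] are not bounded, whence the truncation
   at the levels [K k]; the remainders are controlled by [(W - K k)^+]. *)
Lemma compactness_property_order_compact a : (0 < a)%R ->
  compactness_property X P (B1 R E) m -> order_compact X P m a.
Proof.
move=> a0 cpt v v0; apply: cvg_subsequence_precompact => w Aw.
have /choice[u /all_and2[vu Ruw]] n : exists u,
    order_interval v u /\ resolvent_L1 X P a u (w n).
  by have [u ? ?] := Aw n; exists u.
(* Classes are ordered almost everywhere only; clipping gives [0 <= f n <= W] at every point, as the
   comparison of resolvents requires. *)
pose W (y : Borel E) : R := Num.max (L1val v y) 0%R.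
pose f n (y : Borel E) : R := Num.min (Num.max (L1val (u n) y) 0%R) (W y).
pose K (k : nat) : R := k.+1%:R.
pose g k n (y : Borel E) : R := Num.min (f n y) (K k).
have K0 k : (0 < K k)%R by exact: ltr0Sn.
have W0 y : (0 <= W y)%R by rewrite /W le_max lexx orbT.
have f0 n y : (0 <= f n y)%R by rewrite /f le_min W0 le_max lexx orbT.
have fW n y : (f n y <= W y)%R by rewrite /f ge_min lexx orbT.
have g0 k n y : (0 <= g k n y)%R by rewrite /g le_min f0 ltW.
have mW : measurable_fun setT W.
  by apply: measurable_maxr => //; exact: L1val_measurable.
have mf n : measurable_fun setT (f n).
  apply: measurable_minr => //; apply: measurable_maxr => //.
  exact: L1val_measurable.
have mg k n : measurable_fun setT (g k n) by exact: measurable_minr.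
have mEW : measurable_fun setT (EFin \o W) by exact/measurable_EFinP.
have mEf n : measurable_fun setT (EFin \o f n) by exact/measurable_EFinP.
have mEg k n : measurable_fun setT (EFin \o g k n) by exact/measurable_EFinP.
have Rf n : \forall x \ae m, (L1val (w n) x)%:E = resolvent X P a (EFin \o f n) x.
  have uf : \forall x \ae m, (EFin \o L1val (u n)) x = (EFin \o f n) x.
    apply: filterS (vu n) => x /andP[ux uvx] /=.
    by rewrite /f /W max_l// max_l ?(le_trans ux)// min_l.
  by apply: filterS2 (Ruw n) (excessive_resolvent_ae_eq a0 uf) => x -> ->.
pose Q k (phi : nat -> nat) := \forall x \ae m, exists l : R,
  resolvent X P a (EFin \o g k (phi n)) x @[n --> \oo] --> l%:E.
have [||phi iphi Qphi] := @diagonal_subsequence Q.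
- move=> k phi iphi.
  (* Division by the level [K k > 0] brings the truncations into [B1]; the factor is restored by
     homogeneity. *)
  pose u' n (y : E) : \bar R := ((K k)^-1 * g k (phi n) y)%:E.
  have u'0 n y : 0 <= u' n y by rewrite lee_fin mulr_ge0// invr_ge0 ltW.
  have mu' n : measurable_fun [set: Borel E] (u' n).
    by apply/measurable_EFinP; exact: measurable_funM.
  have B1u' n : B1 R E (u' n).
    split=> [//|y]; rewrite lee_fin mulrC ler_pdivrMr// mul1r.
    by rewrite /g ge_min lexx orbT.
  have [psi ipsi Ru'] := compactness_property_subsequence a0 cpt B1u'.
  exists psi; [exact: ipsi|]; apply: filterS Ru' => x [l u'l].
  exists (K k * l)%R.
  have gE n : EFin \o g k (phi n) = fun y => (K k)%:E * u' n y.
    by apply/funext => y; rewrite /u' -EFinM mulrA divff ?gt_eqF// mul1r.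
  have RgE n : resolvent X P a (EFin \o g k (phi (psi n))) x =
      (K k)%:E * resolvent X P a (u' (psi n)) x.
    by rewrite gE resolventZ// ltW.
  rewrite /comp; under eq_fun do rewrite RgE.
  by rewrite EFinM; exact: cvgeZl.
- move=> k phi psi N rho irho Qphi psiE; apply: filterS Qphi => x [l gl]; exists l.
  exact: (@cvg_subsequence_tail _ (fun n => resolvent X P a (EFin \o g k n) x)
    _ _ _ _ _ irho psiE gl).
have Woo : \int[m]_y (EFin \o W) y < +oo.
  have /integrableP[_] := L1val_integrable v; apply: le_lt_trans.
  apply: ge0_le_integral => //.
  - by move=> y _; rewrite lee_fin.
  - apply: measurableT_comp => //.
    by have /integrableP[] := L1val_integrable v.
  - by move=> y _; rewrite lee_fin /W ge_max ler_norm normr_ge0.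
have [G [iG G0 _ RWG]] := integrable_resolvent a0 mEW
  (fun y => W0 y) Woo.
have RWfin : \forall x \ae m, resolvent X P a (EFin \o W) x < +oo.
  have := integrable_ae measurableT iG; apply: filterS2 RWG => x -> /(_ Logic.I).
  by rewrite ge0_fin_numE.
have Rfl : \forall x \ae m, exists l : R,
    resolvent X P a (EFin \o f (phi n)) x @[n --> \oo] --> l%:E.
  apply: filterS2 (ae_foralln Qphi) RWfin => x gl RW.
  have [V Vx] := potential_measure radonE rightX x a0.
  pose H k (y : Borel E) : R := Num.max (W y - K k)%R 0%R.
  have H0 k y : (0 <= H k y)%R by rewrite /H le_max lexx orbT.
  have mH k : measurable_fun setT (EFin \o H k).
    by apply/measurable_EFinP; apply: measurable_maxr => //; exact: measurable_funB.
  apply: (@cvg_squeeze_approximation _ _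
      (fun k n => resolvent X P a (EFin \o g k (phi n)) x)
      (fun k => \int[V]_y (H k y)%:E)) => //.
  - by move=> k n; apply: resolvent_ge0 => y; rewrite lee_fin.
  - move=> k n; apply: le_resolvent => // y; rewrite lee_fin//.
    by rewrite /g ge_min lexx.
  - move=> k n; rewrite !Vx//; try by move=> y; rewrite lee_fin.
    rewrite -ge0_integralD//; try exact: (mH k); try by move=> y _; rewrite lee_fin.
    apply: ge0_le_integral => //; first by move=> y _; rewrite lee_fin.
      exact: (emeasurable_funD (mEg k (phi n)) (mH k)).
    move=> y _; rewrite -EFinD lee_fin /g /H.
    have := fW (phi n) y; case: (leP (f (phi n) y) (K k)) => fK fWy.
      by rewrite lerDl le_max lexx orbT.
    by rewrite -lerBlDl le_max lerB.
  - apply: (integral_dominated_cvg0 mH mEW).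
    + by move=> k y; rewrite lee_fin.
    + by move=> k y; rewrite lee_fin /H ge_max W0 gerBl ltW.
    + by rewrite -Vx// => y; rewrite lee_fin.
    + move=> y; apply: cvg_near_cst; exists (Num.truncn (W y)) => // k /= Wk.
      congr EFin; rewrite /H max_r// subr_le0 ltW// (lt_le_trans (truncnS_gt _))//.
      by rewrite ler_nat ltnS.
have [|||z wz] := @L1_dominated_cvg _ _ _ m (w \o phi) G.
- exact: iG.
- move=> n; apply: filterS2 (Rf (phi n)) RWG => x RfE <-.
  rewrite -[(w \o phi) n]/(w (phi n)) RfE gee0_abs; first by apply: le_resolvent => // y; rewrite lee_fin.
  by apply: resolvent_ge0 => y; rewrite lee_fin.
- apply: filterS2 (ae_foralln Rf) Rfl => x RfE [l fl]; exists l.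
  have wl : (L1val (w (phi n)) x)%:E @[n --> \oo] --> l%:E.
    by under eq_fun do rewrite RfE.
  exact: (fine_cvg wl).
by exists phi, z.
Qed.

Lemma order_compact_compactness_property a : (0 < a)%R ->
  order_compact X P m a -> compactness_property X P (B1 R E) m.
Proof.
move=> a0 oca u B1u.
have mu n : measurable_fun [set: Borel E] (u n) by have [[]] := B1u n.
have u0 n y : 0 <= u n y by have [[_ +] _] := B1u n; exact.
have u1 n y : u n y <= 1 by have [_] := B1u n; exact.
have ufin n y : u n y \is a fin_num.
  by rewrite ge0_fin_numE//; exact: le_lt_trans (u1 n y) (ltry _).
have [F TF /all_and2[mF mFoo]] := sigma_finiteT m.
pose D k := \big[setU/set0]_(i < k) F i.
have mD k : measurable (D k) by exact: bigsetU_measurable.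
have mDoo k : m (D k) < +oo.
  elim: k => [|k IH]; first by rewrite /D big_ord0 measure0 ltry.
  rewrite /D big_ord_recr; apply: le_lt_trans (measureU2 _ (mD k) (mF k)) _.
  by apply: lte_add_pinfty; [exact: IH|exact: mFoo].
pose g k n (y : Borel E) : R := (fine (u n y) * \1_(D k) y)%R.
have g0 k n y : (0 <= g k n y)%R by rewrite mulr_ge0 ?fine_ge0.
have gD k n y : (g k n y <= \1_(D k) y)%R.
  by rewrite ler_piMl// -lee_fin fineK.
have mg k n : measurable_fun setT (g k n).
  by apply: measurable_funM => //; exact: measurableT_comp.
have mEg k n : measurable_fun setT (EFin \o g k n) by exact/measurable_EFinP.
have iD k : m.-integrable setT (EFin \o \1_(D k)).
  apply/integrableP; split; first by apply/measurable_EFinP; exact: measurable_indic.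
  rewrite (eq_integral (EFin \o \1_(D k))); last by move=> y _; rewrite gee0_abs// lee_fin.
  by rewrite integral_indic// setIT; exact: mDoo.
have /choice[v vD] k : exists v : L1 m, \forall x \ae m, L1val v x = \1_(D k) x.
  exact: exists_L1 (iD k).
have v0 k : \forall x \ae m, (0 <= L1val (v k) x)%R.
  by apply: filterS (vD k) => x ->.
pose A k := [set w | exists2 u, order_interval (v k) u & resolvent_L1 X P a u w].
have /choice[w /all_and2[Aw wR]] (kn : nat * nat) : exists w : L1 m, A kn.1 w /\
    \forall x \ae m, (L1val w x)%:E = resolvent X P a (EFin \o g kn.1 kn.2) x.
  case: kn => k n /=.
  have ig : m.-integrable setT (EFin \o g k n).
    apply: (le_integrable measurableT _ _ (iD k)) => //.
    by move=> y _ /=; rewrite lee_fin !ger0_norm.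
  have goo : \int[m]_y (EFin \o g k n) y < +oo.
    have /integrableP[_] := ig; apply: le_lt_trans.
    by rewrite le_eqVlt; apply/orP; left; apply/eqP; apply: eq_integral => y _ /=; rewrite ger0_norm.
  have [U Ug] := exists_L1 ig.
  have [G [iG G0 _ RG]] := integrable_resolvent a0 (mEg k n)
    (fun y => g0 k n y) goo.
  have [w wG] := exists_L1_ereal iG.
  have wRg : \forall x \ae m, (L1val w x)%:E = resolvent X P a (EFin \o g k n) x.
    by apply: filterS2 wG RG => x -> ->.
  exists w; split => //; exists U.
    by apply: filterS2 Ug (vD k) => x -> ->; rewrite g0 gD.
  have UgE : \forall x \ae m, (EFin \o L1val U) x = (EFin \o g k n) x.
    by apply: filterS Ug => x /= ->.
  by apply: filterS2 wRg (excessive_resolvent_ae_eq a0 UgE) => x -> ->.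
pose Q k (phi : nat -> nat) := \forall x \ae m, exists l : R,
  resolvent X P a (EFin \o g k (phi n)) x @[n --> \oo] --> l%:E.
have [||phi iphi Qphi] := @diagonal_subsequence Q.
- move=> k phi iphi.
  (* These radii are summable with sum 1, so the distances to [z] are summable too. *)
  pose r n : R := (1 / (2 ^ (n + 1))%:R)%R.
  have r0 n : (0 < r n)%R by rewrite divr_gt0// ltr0n expn_gt0.
  have [psi [z [ipsi zw]]] := precompact_cvg_subsequence r0 (oca (v k) (v0 k))
    (fun n => Aw (k, phi n)).
  exists psi; [exact: ipsi|].
  have : \sum_(n <oo) (L1dist z (w (k, phi (psi n))))%:E < +oo.
    apply: (@le_lt_trans _ _ (\sum_(n <oo) (r n)%:E)).
      apply: lee_nneseries => [n _ _|n _]; last by rewrite lee_fin ltW//; exact: zw.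
      by rewrite L1distE integral_ge0.
    by rewrite (cvg_lim _ (@cvg_geometric_eseries_half R 1%R 0%N))// ltry.
  move=> /L1_summable_cvg_ae wz.
  have wRn := ae_foralln (fun n => wR (k, phi (psi n))).
  apply: filterS2 wz wRn => x wz wRx; exists (L1val z x).
  rewrite /comp; under eq_fun do rewrite -wRx.
  by apply: cvg_EFin; [exact: nearW|exact: wz].
- move=> k phi psi N rho irho Qphi psiE; apply: filterS Qphi => x [l gl]; exists l.
  exact: (@cvg_subsequence_tail _ (fun n => resolvent X P a (EFin \o g k n) x)
    _ _ _ _ _ irho psiE gl).
(* All positive rates are admissible: convergence at [a] passes to each [b]. *)
exists [set b | (0 < b)%R], phi; split => //.
  apply/eqyP => b b0; apply: ereal_sup_ubound; exists b => //.
move=> b b0; apply: (resolvent_cvg_change a0 b0) => //.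
apply: filterS (ae_foralln Qphi) => x gl.
have [V Vx] := potential_measure radonE rightX x a0.
pose H k : Borel E -> R := \1_(~` D k).
have mH k : measurable_fun setT (EFin \o H k).
  by apply/measurable_EFinP; apply: measurable_indic; exact: measurableC.
apply: (@cvg_squeeze_approximation _ _
    (fun k n => resolvent X P a (EFin \o g k (phi n)) x)
    (fun k => \int[V]_y (H k y)%:E)) => //.
- by move=> k n; apply: resolvent_ge0 => y; rewrite lee_fin.
- move=> k n; apply: le_resolvent => // y; first by rewrite lee_fin.
  by rewrite -[leRHS]fineK// lee_fin ler_piMr ?fine_ge0//= indicE lern1 leq_b1.
- move=> k n; rewrite !Vx//; try by move=> y; rewrite lee_fin.
  rewrite -ge0_integralD//; try exact: (mH k); try by move=> y _; rewrite lee_fin.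
  apply: ge0_le_integral => //; first exact: (emeasurable_funD (mEg k (phi n)) (mH k)).
  move=> y _; have -> : (H k y = 1 - \1_(D k) y)%R.
    by rewrite /H !indicE in_setC; case: (y \in D k); rewrite ?subrr ?subr0.
  rewrite /= /g indicE; case: (y \in D k) => /=.
    by rewrite mulr1 subrr adde0 fineK.
  by rewrite mulr0 subr0 add0e.
(* The constant 1 is integrable because the potential measure of a positive rate is finite. *)
- apply: (@integral_dominated_cvg0 _ _ _ V _ (cst 1)) => //.
  + by move=> k y; rewrite lee_fin.
  + by move=> k y; rewrite lee_fin /H indicE lern1 leq_b1.
  + by rewrite integral_cst//= mul1e ltey_eq fin_num_measure.
  + move=> y; have [i _ Fiy] : (\bigcup_i F i) y by rewrite -TF.
    apply: cvg_near_cst; exists i.+1 => // k /= ik.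
    congr EFin; rewrite /H indicE in_setC mem_set//=.
    by rewrite /D -bigcup_mkord; exists i.
Qed.

End ExcessiveMeasure.

Local Close Scope ereal_scope.

Theorem proposition4p4
    (R : realType) (E : ptopologicalType) (radonE : radon_metrizable R E)
    (dO : measure_display) (Omega : measurableType dO)
    (X : R -> Omega -> option E) (P : E -> probability Omega R)
    (rightX : right_process X P)
    (m : {sigma_finite_measure set (Borel E) -> \bar R})
    (excm : excessive_measure X P m) :
  (compactness_property X P (B1 R E) m <->
     exists a : R, 0 < a /\ order_compact X P m a) /\
  ((exists a : R, 0 < a /\ order_compact X P m a) ->
     forall a : R, 0 < a -> order_compact X P m a).
Proof.
(* The compactness property does not depend on a rate, so passing through it carries order
   compactness from one [a] to all. *)
have oc_cp : (exists a : R, 0 < a /\ order_compact X P m a) ->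
    compactness_property X P (B1 R E) m.
  by move=> [a [a0 oca]]; exact: order_compact_compactness_property oca.
split; [split=> // cpt|move=> /oc_cp cpt a a0].
  exists 1%R; split; first exact: ltr01.
  exact: compactness_property_order_compact.
exact: compactness_property_order_compact.
Qed.
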